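(* Let $\pi:(X,T)\to(Y,T)$ be a RIC (respectively RIC and weakly mixing) extension between minimal systems such that $X_\infty$ is a factor of $Y$ (i.e. the quotient map $X\to X_\infty$ factors through $\pi$). Then for each $d\in\mathbb{N}$, the map $\pi^{(d)}:(N_d(X),\mathcal{G}_d(T))\to(N_d(Y),\mathcal{G}_d(T))$ is also RIC (respectively RIC and weakly mixing).
   Context: For a minimal $(X,T)$ and $d\in\mathbb{N}$, $(x,y)\in{\bf RP}^{[d]}$ if for every $\delta>0$ there are $x',y'\in X$ and $(n_1,\dots,n_d)\in\mathbb{Z}^d$ with $\rho(x,x')<\delta$, $\rho(y,y')<\delta$ and $\rho(T^{\sum n_i\epsilon_i}x',T^{\sum n_i\epsilon_i}y')<\delta$ for all $\epsilon\in\{0,1\}^d\setminus\{0\}$; ${\bf RP}^{[\infty]}=\bigcap_d{\bf RP}^{[d]}$ is a closed invariant equivalence relation and $X_\infty=X/{\bf RP}^{[\infty]}$. $N_d(X)=\overline{\{(T^{p+q}x,\dots,T^{p+dq}x)\}}$, $\mathcal{G}_d(T)=\langle T\times\cdots\times T,\,T\times T^2\times\cdots\times T^d\rangle$, $\pi^{(d)}=\pi\times\cdots\times\pi$. For an extension $\phi:(X,G)\to(Y,G)$, $R_\phi^n=\{(x_1,\dots,x_n):\phi(x_1)=\cdots=\phi(x_n)\}$, $R_\phi=R_\phi^2$; $\phi$ is RIC if it is open and for every $n\ge1$ the minimal points of $R_\phi^n$ under the diagonal $G$-action are dense in $R^n_\phi$; $\phi$ is weakly mixing if $(R_\phi,G)$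 with the diagonal action is topologically transitive. *)

(* Defs.v *)
From HB Require Import structures.
From mathcomp Require Import all_boot all_order all_algebra.
From mathcomp Require Import all_classical all_reals topology.
Unset Printing Implicit Defensive.
Import Order.TTheory GRing.Theory Num.Theory.
Local Open Scope classical_set_scope.
Local Open Scope ring_scope.

Section Dyn.
Context {I : Type} {Z : topologicalType} (a : I -> Z -> Z).

Definition invariant (A : set Z) := forall i z, A z -> A (a i z).
Definition orbit (z : Z) : set Z := [set a i z | i in [set: I]].

Definition minimal_set (M : set Z) :=
  [/\ M !=set0, closed M, invariant M &
      forall N, N `<=` M -> N !=set0 -> closed N -> invariant N -> N = M].

Definition minimal_point (z : Z) := minimal_set (closure (orbit z)).

Definition topologically_transitive (A : set Z) :=
  forall U V : set Z, open U -> open V -> (U `&` A) !=set0 -> (V `&` A) !=set0 ->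
  exists i z, (U `&` A) z /\ (V `&` A) (a i z).
End Dyn.

Definition diag_act {I : Type} {X : topologicalType} (a : I -> X -> X) (n : nat)
  : I -> {ptws 'I_n -> X} -> {ptws 'I_n -> X} :=
  fun i x k => a i (x k).

Definition fibre_power {X Y : topologicalType} (phi : X -> Y) (A : set X) (n : nat)
  : set {ptws 'I_n -> X} :=
  [set x | (forall k, A (x k)) /\ forall k l, phi (x k) = phi (x l)].

Section Ext.
Context {I : Type} {X Y : topologicalType} (a : I -> X -> X) (b : I -> Y -> Y)
  (A : set X) (B : set Y) (phi : X -> Y).

Definition extension :=
  [/\ {within A, continuous phi}, phi @` A = B &
      forall i x, A x -> phi (a i x) = b i (phi x)].

Definition open_onto :=
  forall U : set X, open U -> exists V : set Y, open V /\ phi @` (U `&` A) = V `&` B.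

Definition RIC :=
  [/\ extension, open_onto &
      forall n : nat, (1 <= n)%N ->
        fibre_power phi A n `<=`
        closure ([set x | minimal_point (diag_act a n) x] `&` fibre_power phi A n)].

Definition weakly_mixing_ext :=
  extension /\ topologically_transitive (diag_act a 2) (fibre_power phi A 2).
End Ext.

Definition homeomorphism {X : topologicalType} (T Tinv : X -> X) :=
  [/\ continuous T, continuous Tinv, cancel T Tinv & cancel Tinv T].

Definition Tpow {X : Type} (T Tinv : X -> X) (n : int) : X -> X :=
  match n with Posz k => iter k T | Negz k => iter k.+1 Tinv end.

Definition RP {R : realType} {X : pseudoMetricType R} (T Tinv : X -> X) (d : nat)
  (x y : X) :=
  forall delta : R, 0 < delta ->
  exists (x' y' : X) (n : 'I_d -> int),
    [/\ ball x delta x', ball y delta y' &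
      forall eps : 'I_d -> bool, (exists i, eps i) ->
        let m := \sum_(i < d) (if eps i then n i else 0) in
        ball (Tpow T Tinv m x') delta (Tpow T Tinv m y')].

Definition RPinf {R : realType} {X : pseudoMetricType R} (T Tinv : X -> X) (x y : X) :=
  forall d : nat, RP T Tinv d x y.

Definition Nd {X : topologicalType} (T Tinv : X -> X) (d : nat) : set {ptws 'I_d -> X} :=
  closure [set z : {ptws 'I_d -> X} | exists (x : X) (p q : int),
                     z = (fun i : 'I_d => Tpow T Tinv (p + q * (i.+1)%:Z) x)].

(* the two generators of G_d(T) (and their inverses) acting on X^d:
   (false, _) = T x ... x T, (true, _) = T x T^2 x ... x T^d;
   second component true = inverse *)
Definition Gd_gen {X : topologicalType} (T Tinv : X -> X) (d : nat) (g : bool * bool)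
  : {ptws 'I_d -> X} -> {ptws 'I_d -> X} :=
  fun z i => let S := if g.2 then Tinv else T in
             if g.1 then iter i.+1 S (z i) else S (z i).

Definition Gd_act {X : topologicalType} (T Tinv : X -> X) (d : nat) (w : seq (bool * bool))
  : {ptws 'I_d -> X} -> {ptws 'I_d -> X} :=
  foldr (fun g f => Gd_gen T Tinv d g \o f) id w.

Definition pi_pow {X Y : topologicalType} (pi : X -> Y) (d : nat)
  : {ptws 'I_d -> X} -> {ptws 'I_d -> Y} := fun z i => pi (z i).

(* Main.v *)
(** Everything rests on the saturation of N_d(X): if z is in N_d(X) and
    pi z' = pi z coordinatewise, then z' is in N_d(X).  It suffices to change one
    coordinate i0.  Ellis semigroups show that diagonal points are minimal for
    the progression action and for the face action on cubes; with Baire's theorem,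
    regional proximality of all orders along the fibres and openness of pi this
    yields, densely often, points x and finite IP-systems p_1, ..., p_r with
    T^{p_S} x in a prescribed open set V for every nonempty S.  Again by Baire,
    x may be taken as coordinate i0 of a point of N_d(X) returning syndetically
    near z in the direction fixing i0, and the Hales-Jewett theorem then finds S
    for which T^{p_S} carries coordinate i0 into V while the others come back
    to z.

    Given saturation, pi^(d) is open because pi is, and a T-minimal tuple of a
    fibre of pi is minimal for G_d(T), which transports the density of minimal
    points.  For weak mixing, one box coordinate at a time is freed: in a minimal
    orbit closure M, the transitivity of R_pi brings the freed coordinate close
    to a coordinate of M, and a bounded return time of M does the rest. *)
Require Import Defs.
From HB Require Import structures.
From mathcomp Require Import all_boot all_order all_algebra.
From mathcomp Require Import all_classical all_reals topology.
From mathcomp Require Import zify.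
Set Implicit Arguments.
Unset Strict Implicit.
Unset Printing Implicit Defensive.
Import Order.TTheory GRing.Theory Num.Theory.
Local Open Scope classical_set_scope.
Local Open Scope ring_scope.
(* Both names are shadowed by fingraph and eqtype. *)
Local Notation orbit := Defs.orbit.
Local Notation invariant := Defs.invariant.

(** * Compactness and Baire category *)

Lemma finite_subcover (Z : topologicalType) (I : choiceType) (A : set Z)
    (f : I -> set Z) :
  compact A -> (forall i, open (f i)) -> (forall z, A z -> exists i, f i z) ->
  exists s : seq I, forall z, A z -> exists2 i, i \in s & f i z.
Proof.
move=> /compact_near_coveringP cA fo cov.
pose B (s : seq I) : set (seq I) := [set s' | {subset s <= s'}].
have FF : Filter (filter_from setT B).
  apply: filter_fromT_filter; first by exists [::].
  move=> s t; exists (s ++ t) => u sub; split=> i si; apply: sub;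
    by rewrite mem_cat si ?orbT.
have [|s _ sP] := cA (seq I) (filter_from setT B)
    (fun s z => exists2 i, i \in s & f i z) FF.
  move=> z /cov[i fiz]; exists (f i, B [:: i]) => /=.
    by split; [exact: open_nbhs_nbhs | exists [:: i]].
  by move=> [z' s] [/= fiz' sub]; exists i => //; apply: sub; rewrite inE.
by exists s => z Az; apply: (sP s).
Qed.

Lemma chain_bigcap_neq0 (Z : topologicalType) (C : set Z) (F : set (set Z)) :
  compact C -> F !=set0 -> (forall A, F A -> [/\ A `<=` C, closed A & A !=set0]) ->
  total_on F subset -> \bigcap_(A in F) A !=set0.
Proof.
move=> cC F0 FP Ft.
have FF : Filter (filter_from F id).
  apply: filter_from_filter => // A B FA FB.
  by case: (Ft _ _ FA FB) => sub; [exists A|exists B] => // z Az; split=> //;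
    apply: sub.
have PF : ProperFilter (filter_from F id).
  by apply: filter_from_proper => A /FP[].
have [|z [Cz clz]] := cC _ PF.
  by have [A FA] := F0; exists A => //; have [] := FP _ FA.
exists z => A FA; have [_ clA _] := FP _ FA.
by apply: clA => V Vz; apply: clz => //; exists A.
Qed.

(** One application of Zorn's lemma serves minimal invariant sets, minimal subsemigroups and minimal
    left ideals, all given by properties stable under nonempty intersections. *)
Lemma exists_minimal_closed (Z : topologicalType) (P : set Z -> Prop) (C : set Z) :
  compact C -> closed C -> C !=set0 -> P C ->
  (forall F : set (set Z), F !=set0 -> (forall A, F A -> P A) ->
     P (\bigcap_(A in F) A)) ->
  exists M, [/\ M `<=` C, closed M, M !=set0, P M &
    forall N, N `<=` M -> closed N -> N !=set0 -> P N -> N = M].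
Proof.
move=> cC clC C0 PC Pcap.
(* Maximality under unions becomes minimality under intersections on taking complements in [C]. *)
pose Q (A : set Z) := [/\ closed (C `\` A), (C `\` A) !=set0 & P (C `\` A)].
have [|A [[clA A0 PA] Amax]] := @Zorn_bigcup _ Q.
  move=> F FQ Ft; have [F0|/set0P F0] := eqVneq F set0.
    by rewrite F0 bigcup_set0 /Q setD0.
  pose F' := [set C `\` A | A in F].
  have F'0 : F' !=set0 by have [A FA] := F0; exists (C `\` A); exists A.
  have -> : Q (\bigcup_(A in F) A) = 
      [/\ closed (\bigcap_(A in F') A), \bigcap_(A in F') A !=set0 &
        P (\bigcap_(A in F') A)].
    rewrite /Q; suff -> : C `\` \bigcup_(A in F) A = \bigcap_(A in F') A by [].
    apply/seteqP; split=> z.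
      by move=> [Cz nz] _ [A FA <-]; split=> // Az; apply: nz; exists A.
    move=> h; split; last by move=> [A FA Az]; have [] := h _ (imageP _ FA).
    by have [A FA] := F0; have [] := h _ (imageP _ FA).
  split.
  - by apply: closed_bigI => _ [A /FQ[? _ _] <-].
  - apply: (@chain_bigcap_neq0 _ C) => //.
      by move=> _ [A /FQ[? ? _] <-]; split=> // z [].
    move=> _ _ [A FA <-] [B FB <-].
    by case: (Ft _ _ FA FB) => sub; [right|left] => z [Cz nz]; split=> // h;
      apply: nz; apply: sub.
  - by apply: Pcap => // _ [A /FQ[_ _ ?] <-].
exists (C `\` A); split=> // N NA clN N0 PN.
apply/seteqP; split=> // z [Cz Az]; apply: contrapT => Nz.
have CN : C `\` (C `\` N) = N.
  apply/seteqP; split=> t; first by move=> [Ct /not_andP[//|/contrapT]].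
  by move=> Nt; split; [have [] := NA _ Nt|move=> []].
apply: (Amax (A `|` C `\` N)); last first.
  rewrite /Q; suff -> : C `\` (A `|` C `\` N) = N by [].
  rewrite setDUr CN; apply/seteqP; split=> t; first by case.
  by move=> Nt; split=> //; apply: NA.
by split=> [t At|sub]; [left|apply: Az; apply: sub; right].
Qed.

Lemma regular_shrink (Z : topologicalType) (z : Z) (U : set Z) :
  hausdorff_space Z -> compact [set: Z] -> open U -> U z ->
  exists V, [/\ open V, V z & closure V `<=` U].
Proof.
move=> hZ cZ oU Uz.
have reg : {for z, @regular_space Z}.
  by apply: (compact_regular hZ cZ); exact: filterT.
have [|V Vz VU] := reg U.
  exact: open_nbhs_nbhs.
exists (interior V); split; first exact: open_interior.
  exact: Vz.
by apply: subset_trans VU; apply: closureS; exact: interior_subset.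
Qed.

(** Otherwise shrinking open sets whose closures avoid [E 0], [E 1] and so on would have, by
    compactness, a common point in [O] lying in no [E n]. *)
Lemma baire_closed (Z : topologicalType) (O : set Z) (E : nat -> set Z) :
  hausdorff_space Z -> compact [set: Z] -> open O -> O !=set0 ->
  (forall n, closed (E n)) -> (forall z, O z -> exists n, E n z) ->
  exists n (W : set Z), [/\ open W, W !=set0, W `<=` O & W `<=` E n].
Proof.
move=> hZ cZ oO O0 clE cov; apply: contrapT => nE.
pose good (V : set Z) := [/\ open V, V !=set0 & closure V `<=` O].
have step n (V : set Z) : good V ->
    exists V', [/\ good V', closure V' `<=` V & closure V' `&` E n = set0].
  move=> [oV V0 VO].
  have [z [Vz Ez]] : (V `&` ~` E n) !=set0.
    apply: contrapT => h; apply: nE; exists n, V; split=> //.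
      by move=> z Vz; apply: VO; exact: subset_closure.
    by move=> z Vz; apply: contrapT => Ez; apply: h; exists z.
  have oVE : open (V `&` ~` E n) by apply: openI => //; exact: closed_openC.
  have [V' [oV' V'z V'sub]] := regular_shrink hZ cZ oVE (conj Vz Ez).
  exists V'; split.
  - split=> //; first by exists z.
    by move=> t /V'sub[Vt _]; apply: VO; exact: subset_closure.
  - by move=> t /V'sub[].
  - by rewrite -subset0 => t [/V'sub[_ nEt] Et].
have [V0 gV0] : exists V, good V.
  have [z Oz] := O0; have [V [oV Vz VO]] := regular_shrink hZ cZ oO Oz.
  by exists V; split=> //; exists z.
pose G (V : {V : set Z | good V}) n : {V : set Z | good V} :=
  let h := cid (step n (sval V) (svalP V)) in
  exist _ (sval h) (let: And3 g _ _ := svalP h in g).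
pose S := fix S n : {V : set Z | good V} :=
  if n is m.+1 then G (S m) m else exist _ V0 gV0.
have S1 n : closure (sval (S n.+1)) `<=` sval (S n).
  by rewrite /=; case: (cid _) => V' [].
have S2 n : closure (sval (S n.+1)) `&` E n = set0.
  by rewrite /=; case: (cid _) => V' [].
have S3 n m : (n <= m)%N -> closure (sval (S m)) `<=` closure (sval (S n)).
  move=> /subnK <-; elim: (m - n)%N => // k IH.
  apply: subset_trans IH; rewrite addSn; apply: subset_trans (@S1 _) _.
  exact: subset_closure.
have [z zS] : \bigcap_(A in [set closure (sval (S n)) | n in [set: nat]]) A !=set0.
  apply: (chain_bigcap_neq0 cZ).
  - by exists (closure (sval (S 0%N))); exists 0%N.
  - move=> _ [n _ <-]; split=> //; first exact: closed_closure.
    by have [_ [t ?] _] := svalP (S n); exists t; exact: subset_closure.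
  - move=> _ _ [n _ <-] [m _ <-]; case: (leqP n m) => [|/ltnW] /S3; tauto.
have Sz n : closure (sval (S n)) z by apply: zS; exists n.
have [n Ez] : exists n, E n z.
  by apply: cov; have [_ _] := svalP (S 0%N); apply.
by have := S2 n; rewrite -subset0 => /(_ z); apply.
Qed.

Lemma baire_closed_count (Z : topologicalType) (K : countType) (O : set Z)
    (E : K -> set Z) :
  hausdorff_space Z -> compact [set: Z] -> open O -> O !=set0 ->
  (forall k, closed (E k)) -> (forall z, O z -> exists k, E k z) ->
  exists k (W : set Z), [/\ open W, W !=set0, W `<=` O & W `<=` E k].
Proof.
move=> hZ cZ oO O0 clE cov.
pose E' (n : nat) := if @unpickle K n is Some k then E k else set0.
have [||n [W [oW [w Ww] WO WE]]] := @baire_closed Z O E' hZ cZ oO O0.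
- by move=> n; rewrite /E'; case: (unpickle n) => [k|]; [|exact: closed0].
- by move=> z /cov[k Ek]; exists (pickle k); rewrite /E' pickleK.
move: WE; rewrite /E'; case: (unpickle n) => [k|] WE; last by have := WE _ Ww.
by exists k, W; split=> //; exists w.
Qed.

(** Either part of [O] lies outside the first closed set, and that open part is covered by the
    others, or [O] lies inside it. *)
Lemma finite_closed_interior (Z : topologicalType) (I : eqType) (s : seq I)
    (C : I -> set Z) (O : set Z) :
  open O -> O !=set0 -> (forall i, closed (C i)) ->
  (forall z, O z -> exists2 i, i \in s & C i z) ->
  exists2 i, i \in s & interior (C i) !=set0.
Proof.
elim: s O => [|i s IH] O oO O0 clC cov.
  by have [z /cov[]] := O0.
have [[z [Oz Cz]]|h] := pselect ((O `&` ~` C i) !=set0).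
  have [|||j js j0] := IH (O `&` ~` C i) _ _ clC.
  - by apply: openI => //; exact: closed_openC.
  - by exists z.
  - by move=> t [/cov[j]]; rewrite inE => /orP[/eqP ->//|]; exists j.
  - by exists j => //; rewrite inE js orbT.
exists i; first by rewrite inE eqxx.
have [z Oz] := O0; exists z; apply: (filterS _ (open_nbhs_nbhs (conj oO Oz))).
by move=> t Ot; apply: contrapT => Ct; apply: h; exists t.
Qed.

Lemma openP_nbhs (Z : topologicalType) (A : set Z) :
  (forall z, A z -> exists V, [/\ open V, V z & V `<=` A]) -> open A.
Proof.
move=> h; rewrite openE => z /h[V [oV Vz VA]].
by apply: (filterS VA); exact: open_nbhs_nbhs.
Qed.

(** * The Hales-Jewett theorem *)

(** A word over [option A] stands for a combinatorial line, [None] being the variable. *)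
Definition word_subst (A : Type) (a : A) (v : seq (option A)) : seq A :=
  map (odflt a) v.

(** Only the letters of [bs] are substituted, so that induction on the alphabet can run over lists
    while the type [A] stays fixed. *)
Definition mono_line (A : eqType) (K : Type) (r : nat) (bs : seq A)
    (c : seq A -> K) (v : seq (option A)) (k : K) :=
  [/\ size v = r, None \in v & forall b, b \in bs -> c (word_subst b v) = k].

Lemma word_subst_cat (A : Type) (a : A) (v w : seq (option A)) :
  word_subst a (v ++ w) = word_subst a v ++ word_subst a w.
Proof. exact: map_cat. Qed.

Lemma word_subst_const (A : Type) (a : A) (w : seq A) :
  word_subst a (map some w) = w.
Proof. by rewrite /word_subst -map_comp; elim: w => //= x w ->. Qed.

(* Colour focusing: the m lines have distinct colours over bs and all take the
   value f at the remaining letter b. *)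
Lemma hales_jewett_focus (A K : finType) (b b0 : A) (bs : seq A) :
  (forall K' : finType, exists r, forall c : seq A -> K',
     exists v k, mono_line r (b0 :: bs) c v k) ->
  forall m, exists r, forall c : seq A -> K,
    (exists v k, mono_line r (b :: b0 :: bs) c v k) \/
    exists (f : seq A) (L : seq (seq (option A) * K)),
      [/\ size f = r, size L = m, uniq (map snd L) &
        forall p, p \in L ->
          mono_line r (b0 :: bs) c p.1 p.2 /\ word_subst b p.1 = f].
Proof.
move=> HJ; elim=> [|m [r IH]].
  by exists 0%N => c; right; exists [::], [::].
(* A word of length [R] is coloured by the whole colouring it induces on prefixes of length [r]; on
   a monochromatic line the choice of letter in [b0 :: bs] then does not affect [c]. *)
have [R HR] := HJ {ffun r.-tuple A -> K}.
exists (r + R)%N => c.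
have [v' [k' [sv' Nv' v'k]]] := HR (fun w' => [ffun w : r.-tuple A => c (w ++ w')]).
pose c1 w := c (w ++ word_subst b0 v').
have c1E w x : size w = r -> x \in b0 :: bs -> c (w ++ word_subst x v') = c1 w.
  move=> sw xbs; have sw' : size w == r by apply/eqP.
  have /(congr1 (fun f : {ffun r.-tuple A -> K} => f (Tuple sw'))) := v'k _ xbs.
  have /(congr1 (fun f : {ffun r.-tuple A -> K} => f (Tuple sw'))) :=
    v'k _ (mem_head b0 bs).
  by rewrite !ffunE /= /c1 => -> ->.
have line1 v k : mono_line r (b :: b0 :: bs) c1 v k ->
    exists v k, mono_line (r + R) (b :: b0 :: bs) c v k.
  move=> [sv Nv vk]; exists (v ++ map some (word_subst b0 v')), k; split.
  - by rewrite size_cat !size_map sv sv'.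
  - by rewrite mem_cat Nv.
  - by move=> x xbs; rewrite word_subst_cat word_subst_const; exact: vk.
case: (IH c1) => [[v [k /line1 ?]]|[f [L [sf sL uL Lp]]]]; first by left.
(* If the focus already has the colour of one of the lines, that line becomes monochromatic on [b]
   too; otherwise the focus supplies a new colour. *)
have [/mapP[p pL fp]|fL] := boolP (c1 f \in map snd L).
  left; have [[sv Nv vk] vf] := Lp _ pL; apply: (line1 p.1 p.2); split=> // x.
  by rewrite inE => /orP[/eqP ->|/vk //]; rewrite vf.
right; exists (f ++ word_subst b v'),
  ((map some f ++ v', c1 f) :: [seq (p.1 ++ v', p.2) | p <- L]); split.
- by rewrite size_cat size_map sf sv'.
- by rewrite /= size_map sL.
- by rewrite /= -map_comp fL.
- move=> p; rewrite inE => /orP[/eqP ->|/mapP[q qL ->]] /=.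
    split; last by rewrite word_subst_cat word_subst_const.
    split; first by rewrite size_cat size_map sf sv'.
      by rewrite mem_cat Nv' orbT.
    by move=> x xbs; rewrite word_subst_cat word_subst_const c1E.
  have [[sv Nv vk] vf] := Lp _ qL.
  split; last by rewrite word_subst_cat vf.
  split; first by rewrite size_cat sv sv'.
    by rewrite mem_cat Nv.
  by move=> x xbs; rewrite word_subst_cat c1E ?vk// size_map.
Qed.

(** There cannot be more lines of distinct colours than colours, so focusing [#|K|.+1] lines must
    give a monochromatic one. Lists of at most one letter start the induction, as focusing needs a
    reference letter [b0]. *)
Lemma hales_jewett (A : finType) (bs : seq A) (K : finType) :
  exists r, forall c : seq A -> K, exists v k, mono_line r bs c v k.
Proof.
elim: bs K => [|b [|b0 bs] IH] K.
- by exists 1%N => c; exists [:: None], (c [::]).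
- exists 1%N => c; exists [:: None], (c [:: b]); split=> // x.
  by rewrite inE => /eqP ->.
have [r Hr] := hales_jewett_focus K b IH #|K|.+1.
exists r => c; case: (Hr c) => // -[f [L [_ sL uL _]]].
have := max_card (mem (map snd L)).
by rewrite (card_uniqP uL) size_map sL ltnn.
Qed.

(** * Group actions and minimal points *)

Lemma closure_image_sub (Z W : topologicalType) (f : Z -> W) (A : set Z) (B : set W) :
  continuous f -> closed B -> (forall z, A z -> B (f z)) ->
  forall z, closure A z -> B (f z).
Proof.
move=> cf clB AB z clAz.
have cl : closed (f @^-1` B) by apply: preimage_closed => // x _; exact: cf.
by apply: cl; apply: closureS clAz => x /AB.
Qed.

Definition group_action (G : zmodType) (Z : topologicalType) (a : G -> Z -> Z) :=
  [/\ forall z, a 0 z = z, forall g h z, a (g + h) z = a g (a h z) &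
    forall g, continuous (a g)].

Section GroupActions.
Context (G : zmodType) (Z : topologicalType) (a : G -> Z -> Z).
Hypotheses (aG : group_action a) (hZ : hausdorff_space Z) (cZ : compact [set: Z]).

Lemma act_addK g z : a (- g) (a g z) = z.
Proof. by have [a0 aD _] := aG; rewrite -aD addNr a0. Qed.

Lemma act_openI g (U : set Z) : open U -> open (a g @^-1` U).
Proof. by have [_ _ ac] := aG; move=> oU; move/continuousP: (ac g); apply. Qed.

Lemma act_closedI g (U : set Z) : closed U -> closed (a g @^-1` U).
Proof. by have [_ _ ac] := aG; move=> cU; apply: preimage_closed => // z _; exact: ac. Qed.

Lemma orbit_self z : orbit a z z.
Proof. by have [a0 _ _] := aG; exists 0. Qed.

Lemma orbit_closure_invariant z : invariant a (closure (orbit a z)).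
Proof.
have [_ aD ac] := aG => g z' clz'.
have := @closure_image_sub _ _ (a g) (orbit a z) (closure (orbit a z)).
apply=> //; first exact: closed_closure.
move=> _ [h _ <-].
by apply: subset_closure; rewrite -aD; exists (g + h).
Qed.

Lemma orbit_closure_sub (C : set Z) z :
  closed C -> invariant a C -> C z -> closure (orbit a z) `<=` C.
Proof.
move=> clC iC Cz; rewrite closureE; apply: smallest_sub => // _ [g _ <-].
exact: iC.
Qed.

Lemma exists_minimal_set (C : set Z) :
  closed C -> C !=set0 -> invariant a C ->
  exists2 M, M `<=` C & minimal_set a M.
Proof.
move=> clC C0 iC.
have cC : compact C by apply: subclosed_compact clC cZ _.
have [|M [MC clM M0 iM minM]] := exists_minimal_closed cC clC C0 iC.
  by move=> F _ iF g z Fz A FA; exact: (iF _ FA g z (Fz _ FA)).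
by exists M => //; split=> // N NM N0 clN iN; exact: minM.
Qed.

Lemma minimal_set_closure (M : set Z) z :
  minimal_set a M -> M z -> closure (orbit a z) = M.
Proof.
move=> [_ clM iM minM] Mz; apply: minM.
- exact: orbit_closure_sub.
- by exists z; apply: subset_closure; exact: orbit_self.
- exact: closed_closure.
- exact: orbit_closure_invariant.
Qed.

Lemma minimal_set_point (M : set Z) z :
  minimal_set a M -> M z -> minimal_point a z.
Proof. by move=> mM Mz; rewrite /minimal_point (minimal_set_closure mM Mz). Qed.

Lemma minimal_set_syndetic (M U : set Z) :
  minimal_set a M -> open U -> (M `&` U) !=set0 ->
  exists K : seq G, forall z, M z -> exists2 k, k \in K & U (a k z).
Proof.
move=> mM oU [u [Mu Uu]].
have cM : compact M by apply: subclosed_compact cZ _ => //; have [] := mM.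
apply: (finite_subcover cM (fun g => act_openI g oU)) => z Mz.
have := Mu; rewrite -(minimal_set_closure mM Mz) => /(_ U) [].
  exact: open_nbhs_nbhs.
by move=> _ [[g _ <-] Ugz]; exists g.
Qed.

(** Minimality is syndetic recurrence. For the converse, a closed invariant [N] missing [z] misses
    [closure V] for some open [V] around [z]; finitely many translates of [closure V] cover the
    orbit closure, so one of them meets [N], and invariance brings a point of [N] into
    [closure V]. *)
Lemma minimal_pointP z : minimal_point a z <->
  forall U, open U -> U z ->
    exists K : seq G, forall g, exists2 k, k \in K & U (a (k + g) z).
Proof.
have [a0 aD ac] := aG; split=> [mz U oU Uz|ret].
  have [|K KP] := minimal_set_syndetic mz oU.
    by exists z; split=> //; apply: subset_closure; exact: orbit_self.
  exists K => g; have [|k kK Uk] := KP (a g z); last by exists k; rewrite ?aD.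
  by apply: subset_closure; exists g.
split.
- by exists z; apply: subset_closure; exact: orbit_self.
- exact: closed_closure.
- exact: orbit_closure_invariant.
move=> N NM [w Nw] clN iN; apply/seteqP; split=> //.
apply: orbit_closure_sub => //; apply: contrapT => Nz.
have [V [oV Vz VN]] := regular_shrink hZ cZ (closed_openC clN) Nz.
have [K KP] := ret V oV Vz.
have clB : closed (\bigcup_(k in [set` K]) (a k @^-1` closure V)).
  apply: closed_bigcup => [|k _]; last by apply: act_closedI; exact: closed_closure.
  exact: finite_seq.
have sub : orbit a z `<=` \bigcup_(k in [set` K]) (a k @^-1` closure V).
  move=> _ [g _ <-]; have [k kK Vk] := KP g; exists k => //=.
  by rewrite -aD; exact: subset_closure.
have /clB [k _ /= /VN] := closureS sub (NM _ Nw); apply.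
exact: iN.
Qed.

End GroupActions.

(** * Powers of a space in the pointwise topology *)

Section Pointwise.
Context (E : choiceType) (X : topologicalType).

Lemma ptws_eval_continuous (e : E) : continuous (fun z : {ptws E -> X} => z e).
Proof. exact: (@proj_continuous E (fun=> X) e). Qed.

Lemma ptws_continuous (W : topologicalType) (f : W -> {ptws E -> X}) :
  (forall e, continuous (fun w => f w e)) -> continuous f.
Proof.
move=> fc w; apply/cvg_sup => e U [V] [[O oO <-] Ofw VU].
apply: (filterS VU); rewrite nbhs_simpl.
have : nbhs (f w e) O by exact: open_nbhs_nbhs.
exact: fc.
Qed.

Lemma ptws_hausdorff : hausdorff_space X -> hausdorff_space {ptws E -> X}.
Proof. by move=> hX; apply: (@hausdorff_product E (fun=> X)). Qed.

Lemma ptws_compact : compact [set: X] -> compact [set: {ptws E -> X}].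
Proof.
move=> cX; have := @tychonoff E (fun=> X) (fun=> setT) (fun=> cX).
by congr compact; apply/seteqP; split.
Qed.

End Pointwise.

Section Boxes.
Context (E : finType) (X : topologicalType).

Definition box (V : E -> set X) : set {ptws E -> X} := [set z | forall e, V e (z e)].

Lemma box_open (V : E -> set X) : (forall e, open (V e)) -> open (box V).
Proof.
move=> oV; rewrite openE => z Vz.
apply: (@filter_forall _ E (fun e (w : {ptws E -> X}) => V e (w e)) (nbhs z)) => e.
exact: (@ptws_eval_continuous E X e z (V e) (open_nbhs_nbhs (conj (oV e) (Vz e)))).
Qed.

Lemma box_nbhs (z : {ptws E -> X}) (U : set {ptws E -> X}) :
  open U -> U z ->
  exists V : E -> set X, [/\ forall e, open (V e), box V z & box V `<=` U].
Proof.
move=> oU Uz; have nU : nbhs z U by exact: open_nbhs_nbhs.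
pose D := [set V : E -> set X | (forall e, open (V e)) /\ box V z].
have FF : Filter (filter_from D box).
  apply: filter_from_filter; first by exists (fun=> setT); split=> // e; exact: openT.
  move=> V W [oV Vz] [oW Wz]; exists (fun e => V e `&` W e).
    by split=> e; [exact: openI | split; [exact: Vz | exact: Wz]].
  by move=> w VW; split=> e; have [] := VW e.
have /(_ U nU)[V [oV Vz] VU] : filter_from D box --> z; last by exists V.
apply/cvg_sup => e B [B' [[O oO <-] Oz OB]].
exists (fun e' => if e' == e then O else setT).
  split=> e'; first by case: ifP => // _; exact: openT.
  by case: eqP => [->|].
by move=> w /(_ e); rewrite eqxx => Ow; exact: OB.
Qed.

End Boxes.

(** * Ellis semigroups *)

Section TopologicalSemigroup.
Context (S : topologicalType) (mul : S -> S -> S).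
Hypotheses (hS : hausdorff_space S) (mulA : associative mul)
  (mulc : forall q, continuous (mul^~ q)).

Definition subsemigroup (C : set S) := forall p q, C p -> C q -> C (mul p q).

Definition left_ideal (C L : set S) := forall p q, C p -> L q -> L (mul p q).

Lemma right_translate_closed (C : set S) q : compact C -> closed (mul^~ q @` C).
Proof.
move=> cC; apply: compact_closed => //; apply: continuous_compact => //.
by apply: continuous_subspaceT => p; exact: mulc.
Qed.

Lemma right_fixed_closed (C : set S) q r : closed C -> closed [set p | C p /\ mul p q = r].
Proof.
move=> clC; apply: closedI => //.
apply: (@preimage_closed _ _ (mul^~ q) [set r]) => [p _|]; first exact: mulc.
exact/accessible_closed_set1/hausdorff_accessible.
Qed.

(** The Ellis-Numakura argument: in a minimal closed subsemigroup [M] containing [e], first [M e]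
    and then the set of [p] with [p e = e] are nonempty closed subsemigroups, so both equal [M],
    which makes [e] idempotent. *)
Lemma exists_idempotent (C : set S) :
  compact C -> closed C -> C !=set0 -> subsemigroup C ->
  exists2 e, C e & mul e e = e.
Proof.
move=> cC clC C0 sC.
have [|M [MC clM [e Me] sM minM]] := exists_minimal_closed cC clC C0 sC.
  by move=> F _ FS p q Fp Fq A FA; apply: FS => //; [exact: Fp|exact: Fq].
have cM : compact M by exact: subclosed_compact clM cC MC.
have MeM : mul^~ e @` M = M.
  apply: minM.
  - by move=> _ [p Mp <-]; exact: sM.
  - exact: right_translate_closed.
  - by exists (mul e e); exists e.
  - by move=> _ _ [p Mp <-] [q Mq <-]; exists (mul (mul p e) q);
      [exact: sM (sM _ _ Mp Me) Mq|rewrite !mulA].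
have fixM : [set p | M p /\ mul p e = e] = M.
  apply: minM.
  - by move=> p [].
  - exact: right_fixed_closed.
  - by have := Me; rewrite -{1}MeM => -[p Mp pe]; exists p.
  - move=> p q [Mp pe] [Mq qe]; split; first exact: sM.
    by rewrite -mulA qe pe.
exists e; first exact: MC.
by have := Me; rewrite -{1}fixM => -[].
Qed.

(** Minimality gives [L e = L] for an idempotent [e] of [L], so [e] acts on [L] as a right
    identity. *)
Lemma exists_minimal_left_ideal (C : set S) :
  compact C -> closed C -> C !=set0 -> subsemigroup C ->
  exists L, [/\ L `<=` C, closed L, L !=set0, left_ideal C L &
    forall e q, L e -> mul e e = e -> L q -> mul q e = q].
Proof.
move=> cC clC C0 sC.
have [|L [LC clL L0 iL minL]] :=
  @exists_minimal_closed S (left_ideal C) C cC clC C0 sC.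
  by move=> F _ FS p q Cp Fq A FA; apply: FS => //; exact: Fq.
exists L; split=> // e q Le ee Lq.
have LeL : mul^~ e @` L = L.
  apply: minL.
  - by move=> _ [p Lp <-]; apply: iL => //; exact: LC.
  - by apply: right_translate_closed; exact: subclosed_compact clL cC LC.
  - by exists (mul e e); exists e.
  - by move=> p _ Cp [r Lr <-]; exists (mul p r); [exact: iL|rewrite mulA].
by have := Lq; rewrite -{1}LeL => -[p Lp <-]; rewrite -mulA ee.
Qed.

End TopologicalSemigroup.

(** * Integer powers and coordinatewise actions on tuples *)

Section Tpow.
Context (X : topologicalType) (T Tinv : X -> X).
Hypothesis hT : homeomorphism T Tinv.

Lemma TpowS (n : int) x : Tpow T Tinv (n + 1) x = T (Tpow T Tinv n x).
Proof.
have [_ _ _ TK] := hT.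
case: n => n; first by rewrite -PoszD addn1.
case: n => [|n]; first by rewrite /= TK.
have -> : Negz n.+1 + 1 = Negz n by lia.
by rewrite /= TK.
Qed.

Lemma TpowD (m n : int) x : Tpow T Tinv (m + n) x = Tpow T Tinv m (Tpow T Tinv n x).
Proof.
have [_ _ TK _] := hT.
have TpowB (k : int) y : Tpow T Tinv (k - 1) y = Tinv (Tpow T Tinv k y).
  by rewrite -[in RHS](subrK 1 k) TpowS TK.
elim/int_rect: m => [|m IH|m IH]; first by rewrite add0r.
  by rewrite -addn1 PoszD addrAC !TpowS IH.
by rewrite -addn1 PoszD opprD addrAC !TpowB IH.
Qed.

Lemma iter_continuous (f : X -> X) n : continuous f -> continuous (iter n f).
Proof.
move=> cf; elim: n => [|n IH] x; first exact: cvg_id.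
by apply: continuous_comp; [exact: IH|exact: cf].
Qed.

Lemma Tpow_continuous (n : int) : continuous (Tpow T Tinv n).
Proof. by have [cT cTi _ _] := hT; case: n => n; exact: iter_continuous. Qed.

Lemma Tpow_action : group_action (Tpow T Tinv).
Proof. by split=> // [g h z|]; [exact: TpowD|exact: Tpow_continuous]. Qed.

Context (G : zmodType) (E : choiceType).

(** The diagonal action, the face action on cubes, the progression action and the direction fixing
    one coordinate are all of this form for suitable exponents [phi]. *)
Definition tuple_act (phi : G -> E -> int) (g : G) (z : {ptws E -> X}) : {ptws E -> X} :=
  fun e => Tpow T Tinv (phi g e) (z e).

Lemma tuple_act_continuous phi g : continuous (tuple_act phi g).
Proof.
apply: ptws_continuous => e z; apply: continuous_comp; first exact: ptws_eval_continuous.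
exact: Tpow_continuous.
Qed.

Lemma tuple_act_action (phi : G -> E -> int) :
  (forall g h e, phi (g + h) e = phi g e + phi h e) -> group_action (tuple_act phi).
Proof.
move=> phiD; have phi0 e : phi 0 e = 0.
  by apply: (addrI (phi 0 e)); rewrite -phiD !addr0.
split=> [z|g h z|]; last exact: tuple_act_continuous.
  by apply/funext => e; rewrite /tuple_act phi0.
by apply/funext => e; rewrite /tuple_act phiD TpowD.
Qed.

End Tpow.

(** * Enveloping semigroups of coordinatewise actions *)

Section Enveloping.
Context (X : topologicalType) (T Tinv : X -> X).
Hypotheses (hT : homeomorphism T Tinv) (hX : hausdorff_space X)
  (cX : compact [set: X]).

(* Coordinatewise maps on X^E: p (e, x) is the image of x under the e-th
   component; composition is componentwise. *)
Definition cmul (E : choiceType) (p q : {ptws E * X -> X}) : {ptws E * X -> X} :=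
  fun ex => p (ex.1, q ex).

Definition ctrans (G : zmodType) (E : choiceType) (phi : G -> E -> int) (g : G) :
  {ptws E * X -> X} := fun ex => Tpow T Tinv (phi g ex.1) ex.2.

Definition enveloping (G : zmodType) (E : choiceType) (phi : G -> E -> int) :=
  closure (range (ctrans phi)).

Lemma cmulA (E : choiceType) : associative (@cmul E).
Proof. by []. Qed.

Lemma cmul_continuousl (E : choiceType) (q : {ptws E * X -> X}) :
  continuous ((@cmul E)^~ q).
Proof. by apply: ptws_continuous => ex; exact: ptws_eval_continuous. Qed.

Lemma ctrans_mul_continuous (G : zmodType) (E : choiceType) (phi : G -> E -> int) g :
  continuous (cmul (ctrans phi g)).
Proof.
apply: ptws_continuous => ex p; apply: (@continuous_comp _ _ _ (fun p : {ptws E * X -> X} => p ex)).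
  exact: ptws_eval_continuous.
exact: (Tpow_continuous hT).
Qed.

Section Forms.
Context (G : zmodType) (E : choiceType) (phi : G -> E -> int).
Hypothesis phiD : forall g h e, phi (g + h) e = phi g e + phi h e.

Lemma enveloping_closed : closed (enveloping phi).
Proof. exact: closed_closure. Qed.

Lemma enveloping_compact : compact (enveloping phi).
Proof.
apply: (subclosed_compact enveloping_closed (ptws_compact cX)) => //.
Qed.

Lemma enveloping_ctrans g : enveloping phi (ctrans phi g).
Proof. by apply: subset_closure; exists g. Qed.

Lemma enveloping_image (W : topologicalType) (f : {ptws E * X -> X} -> W) (B : set W) p :
  enveloping phi p -> continuous f -> closed B -> (forall g, B (f (ctrans phi g))) ->
  B (f p).
Proof.
move=> Ep cf clB Bf; apply: (@closure_image_sub _ _ f _ B cf clB _ p Ep).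
by move=> _ [g _ <-].
Qed.

(** Limits are taken in the left factor first, then in the right one; by then the left factor is a
    translation, which is continuous as a left multiplier. *)
Lemma enveloping_mul : subsemigroup (@cmul E) (enveloping phi).
Proof.
move=> p q Ep Eq.
apply: (@enveloping_image _ (fun p => cmul p q) (enveloping phi) p Ep) => [||g].
- exact: cmul_continuousl.
- exact: closed_closure.
apply: (@enveloping_image _ (cmul (ctrans phi g)) (enveloping phi) q Eq) => [||h].
- exact: ctrans_mul_continuous.
- exact: closed_closure.
apply: subset_closure; exists (g + h) => //; apply/funext => ex.
by rewrite /ctrans /cmul phiD (TpowD hT).
Qed.

Definition cact (p : {ptws E * X -> X}) (z : {ptws E -> X}) : {ptws E -> X} :=
  fun e => p (e, z e).

Lemma cact_continuousl z : continuous (cact^~ z).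
Proof. by apply: ptws_continuous => e; exact: ptws_eval_continuous. Qed.

Lemma orbit_closure_cact z w :
  closure (orbit (tuple_act T Tinv phi) z) w -> exists2 p, enveloping phi p & w = cact p z.
Proof.
have cl : closed (cact^~ z @` enveloping phi).
  apply: compact_closed; first exact: ptws_hausdorff.
  apply: continuous_compact; last exact: enveloping_compact.
  by apply: continuous_subspaceT => p; exact: cact_continuousl.
have sub : orbit (tuple_act T Tinv phi) z `<=` cact^~ z @` enveloping phi.
  by move=> _ [g _ <-]; exists (ctrans phi g); first exact: enveloping_ctrans.
by move=> /(closureS sub)/cl[p Ep <-]; exists p.
Qed.

Lemma cact_closed_invariant (N : set {ptws E -> X}) p z :
  closed N -> invariant (tuple_act T Tinv phi) N -> enveloping phi p -> N z ->
  N (cact p z).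
Proof.
move=> clN iN Ep Nz.
apply: (@enveloping_image _ (cact^~ z) N p Ep) => // g; last exact: iN.
exact: cact_continuousl.
Qed.

End Forms.

Definition diag_form (E : Type) (n : int) (_ : E) : int := n.

(** [u] is performed in all coordinates at once; over the one-point index set [unit] the enveloping
    semigroup is that of [(X, T)] itself. *)
Definition clift (E : choiceType) (u : {ptws unit * X -> X}) : {ptws E * X -> X} :=
  fun ex => u (tt, ex.2).

Definition ccoord (E : choiceType) (e : E) (p : {ptws E * X -> X}) : {ptws unit * X -> X} :=
  fun ex => p (e, ex.2).

Lemma ccoord_enveloping (G : zmodType) (E : choiceType) (phi : G -> E -> int) e p :
  enveloping phi p -> enveloping (@diag_form unit) (ccoord e p).
Proof.
have cc : continuous (ccoord e).
  by apply: ptws_continuous => ex; exact: ptws_eval_continuous.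
move=> Ep.
apply: (@enveloping_image _ _ _ _ (ccoord e) (enveloping (@diag_form unit)) p Ep cc) => [|g].
  exact: closed_closure.
by apply: subset_closure; exists (phi g e) => //; apply/funext => -[[] x].
Qed.

(* With u an idempotent of a minimal left ideal fixing every x e, every w in
   the enveloping semigroup of phi has an idempotent v in E w u; in each
   coordinate u v = u, so x is recovered from w x. *)
Lemma tuple_minimal_point (G : zmodType) (E : choiceType) (phi : G -> E -> int)
    (x : {ptws E -> X}) :
  (forall g h e, phi (g + h) e = phi g e + phi h e) ->
  (forall u, enveloping (@diag_form unit) u -> cmul u u = u ->
     enveloping phi (@clift E u)) ->
  minimal_point (tuple_act T Tinv (@diag_form E)) x ->
  minimal_point (tuple_act T Tinv phi) x.
Proof.
move=> phiD lift minx.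
have diagD (F : Type) (g h : int) (e : F) :
  diag_form (g + h) e = diag_form g e + diag_form h e by [].
have aG := tuple_act_action hT phiD.
have hS (F : choiceType) := @ptws_hausdorff F X hX.
have mulc (F : choiceType) := @cmul_continuousl F.
have EX0 : enveloping (@diag_form unit) !=set0.
  by exists (ctrans (@diag_form unit) 0); exact: enveloping_ctrans.
have cEX : compact (enveloping (@diag_form unit)) by exact: enveloping_compact.
have cEphi : compact (enveloping phi) by exact: enveloping_compact.
have [L [LEX clL [l Ll] iL Le]] := exists_minimal_left_ideal (hS _) (@cmulA _) (mulc _)
  cEX (@closed_closure _ _) EX0 (enveloping_mul (diagD _)).
have cL : compact L by exact: subclosed_compact clL cEX LEX.
pose rho (p : {ptws unit * X -> X}) : {ptws E -> X} := fun e => p (tt, x e).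
have rhoc : continuous rho.
  by apply: ptws_continuous => e; exact: ptws_eval_continuous.
have [u [Lu uu ux]] : exists u, [/\ L u, cmul u u = u & forall e, u (tt, x e) = x e].
  (* The image of the left ideal [L] is a closed invariant part of the orbit closure, hence all of
     it. *)
  have rhoL : rho @` L = closure (orbit (tuple_act T Tinv (@diag_form E)) x).
    have [_ _ _ minN] := minx; apply: minN.
    - move=> _ [p Lp <-].
      apply: (@enveloping_image _ _ _ _ rho _ _ (LEX _ Lp) rhoc) => [|n].
        exact: closed_closure.
      by apply: subset_closure; exists n.
    - by exists (rho l); exists l.
    - apply: compact_closed; first exact: ptws_hausdorff.
      by apply: continuous_compact => //; exact: continuous_subspaceT.
    - move=> n _ [p Lp <-]; exists (cmul (ctrans (@diag_form unit) n) p) => //.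
      by apply: iL => //; exact: enveloping_ctrans.
  have xL : (rho @` L) x.
    by rewrite rhoL; apply: subset_closure; apply: orbit_self; exact: tuple_act_action.
  (* Elements of [L] fixing all [x e] form a nonempty closed subsemigroup, so one of them is
     idempotent. *)
  pose Q := L `&` rho @^-1` [set x].
  have clQ : closed Q.
    apply: closedI => //; apply: preimage_closed => [p _|]; first exact: rhoc.
    exact/accessible_closed_set1/hausdorff_accessible/ptws_hausdorff.
  have sQ : subsemigroup (@cmul _) Q.
    move=> p q [Lp px] [Lq qx]; split; first by apply: iL => //; exact: LEX.
    apply/funext => e; rewrite /rho /cmul /=.
    have /(congr1 (fun f : {ptws E -> X} => f e)) := px; rewrite /rho => pe.
    by have /(congr1 (fun f : {ptws E -> X} => f e)) := qx; rewrite /rho => ->.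
  have [||u [Lu ux] uu] := exists_idempotent (hS _) (@cmulA _) (mulc _) _ clQ _ sQ.
  - by apply: subclosed_compact clQ cL _ => p [].
  - by have [p Lp px] := xL; exists p.
  - by exists u; split=> // e; have /(congr1 (fun f : {ptws E -> X} => f e)) := ux.
split.
- by exists x; apply: subset_closure; exact: orbit_self.
- exact: closed_closure.
- exact: orbit_closure_invariant.
move=> N NM [z Nz] clN iN; apply/seteqP; split=> //.
apply: orbit_closure_sub => //.
have [w Ew zw] := orbit_closure_cact (NM _ Nz).
have Eu := lift u (LEX _ Lu) uu.
have mulE := enveloping_mul phiD.
pose C := (@cmul E)^~ (cmul w (@clift E u)) @` enveloping phi.
have clC : closed C.
  by apply: (right_translate_closed (hS _) (mulc _)).
have CE : C `<=` enveloping phi.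
  by move=> _ [p Ep <-]; exact: (mulE _ _ Ep (mulE _ _ Ew Eu)).
have [|||v [w' Ew' vE] vv] := exists_idempotent (hS _) (@cmulA _) (mulc _) _ clC.
- exact: subclosed_compact clC cEphi CE.
- by exists (cmul w (cmul w (@clift E u))); exists w.
- move=> _ _ [p Ep <-] [q Eq <-].
  exists (cmul (cmul p (cmul w (@clift E u))) q) => //.
  by apply: (mulE _ _ _ Eq); exact: (mulE _ _ Ep (mulE _ _ Ew Eu)).
suff -> : x = cact (cmul (@clift E u) w') z.
  exact: (cact_closed_invariant clN iN (mulE _ _ Eu Ew') Nz).
apply/funext => e; rewrite zw /cact.
have Lv : L (ccoord e v).
  have -> : ccoord e v = cmul (ccoord e (cmul w' w)) u.
    by rewrite -vE; apply/funext => -[[] y].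
  apply: iL => //.
  exact: (@ccoord_enveloping _ _ phi e _ (mulE _ _ Ew' Ew)).
have vve : cmul (ccoord e v) (ccoord e v) = ccoord e v.
  by rewrite -[in RHS]vv.
(* In coordinate [e], [v] is a right identity on [L], so [u v = u]; evaluated at [x e], fixed by
   [u], this says that [u w'] takes the image of [x e] under [w] back to [x e]. *)
have /(congr1 (fun f : {ptws unit * X -> X} => f (tt, x e))) := Le _ _ Lv vve Lu.
by rewrite -vE /cmul /ccoord /clift /= !ux => ->.
Qed.

Lemma clift_diag (G : zmodType) (E : choiceType) (phi : G -> E -> int) (h : int -> G) u :
  (forall n e, phi (h n) e = n) -> enveloping (@diag_form unit) u ->
  enveloping phi (@clift E u).
Proof.
move=> hphi Eu.
have cc : continuous (@clift E).
  by apply: ptws_continuous => ex; exact: ptws_eval_continuous.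
apply: (@enveloping_image _ _ _ _ (@clift E) (enveloping phi) u Eu cc) => [|n].
  exact: closed_closure.
apply: subset_closure; exists (h n) => //; apply/funext => -[e x].
by rewrite /clift /ctrans /= hphi.
Qed.

End Enveloping.

(** * Cubes and minimality of diagonal points *)

Definition cube_sum (d : nat) (eps : 'I_d -> bool) (n : 'I_d -> int) : int :=
  \sum_(i < d) (if eps i then n i else 0).

Lemma cube_sumD d (eps : 'I_d -> bool) (m n : 'I_d -> int) :
  cube_sum eps (fun i => m i + n i) = cube_sum eps m + cube_sum eps n.
Proof.
by rewrite /cube_sum -big_split; apply: eq_bigr => i _; case: (eps i); rewrite ?addr0.
Qed.

(** Vertices are finite functions, so that they form a finite index set for tuples; the zero vertex
    is excluded as in regional proximality. *)
Definition nonzero_vertex (d : nat) := {e : {ffun 'I_d -> bool} | [exists i, e i]}.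

Definition cube_form (d : nat) (n : {ffun 'I_d -> int}) (e : nonzero_vertex d) : int :=
  cube_sum (val e) n.

Lemma cube_formD d (m n : {ffun 'I_d -> int}) e :
  cube_form (m + n) e = cube_form m e + cube_form n e.
Proof. by rewrite /cube_form -cube_sumD; apply: eq_bigr => i _; rewrite ffunE. Qed.

Section MinimalTuples.
Context (X : topologicalType) (T Tinv : X -> X).
Hypotheses (hT : homeomorphism T Tinv) (hX : hausdorff_space X)
  (cX : compact [set: X]).

(* The face transformation in direction j lifts u to the coordinates with
   e j; composing over all directions gives u at every nonzero vertex. *)
Lemma clift_cube d u :
  enveloping T Tinv (@diag_form unit) u -> cmul u u = u ->
  enveloping T Tinv (@cube_form d) (@clift X (nonzero_vertex d) u).
Proof.
move=> Eu uu.
have uuE x : u (tt, u (tt, x)) = u (tt, x).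
  by have /(congr1 (fun f : {ptws unit * X -> X} => f (tt, x))) := uu.
pose face (P : pred 'I_d) : {ptws nonzero_vertex d * X -> X} :=
  fun ex => if [exists i, P i && val ex.1 i] then u (tt, ex.2) else ex.2.
have face1 j : enveloping T Tinv (@cube_form d) (face (pred1 j)).
  pose F (p : {ptws unit * X -> X}) : {ptws nonzero_vertex d * X -> X} :=
    fun ex => if val ex.1 j then p (tt, ex.2) else ex.2.
  have -> : face (pred1 j) = F u.
    apply/funext => -[e x]; rewrite /face /F /=.
    have -> // : [exists i, (i == j) && val e i] = val e j.
    by apply/existsP/idP => [[i /andP[/eqP ->]]//|ej]; exists j; rewrite eqxx.
  apply: (@enveloping_image _ _ _ _ _ _ _ F (enveloping T Tinv (@cube_form d)) u Eu) => [||n].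
  - apply: ptws_continuous => -[e x]; rewrite /F /=; case: (val e j).
      exact: ptws_eval_continuous.
    exact: cst_continuous.
  - exact: closed_closure.
  apply: subset_closure; exists [ffun i => if i == j then n else 0] => //.
  apply/funext => -[e x]; rewrite /F /ctrans /cube_form /cube_sum /=.
  rewrite (bigD1 j) //= ffunE eqxx big1 ?addr0 => [|i /negbTE ij]; last first.
    by rewrite ffunE ij if_same.
  by case: (val e j).
have faces (s : seq 'I_d) : enveloping T Tinv (@cube_form d) (face (mem s)).
  elim: s => [|j s IH].
    apply: subset_closure; exists 0 => //; apply/funext => -[e x].
    rewrite /face /ctrans /cube_form /cube_sum /=.
    have -> : [exists i, (i \in [::]) && val e i] = false.
      by apply/existsP => -[i].
    by rewrite big1 // => i _; rewrite ffunE if_same.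
  (* Where both factors act, idempotence of [u] reduces two applications to one. *)
  have -> : face (mem (j :: s)) = cmul (face (pred1 j)) (face (mem s)).
    apply/funext => -[e x]; rewrite /cmul /face /=.
    have -> : [exists i, (i \in j :: s) && val e i] =
        [exists i, (i == j) && val e i] || [exists i, (i \in s) && val e i].
      apply/existsP/orP => [[i]|[]/existsP[i /andP[]]].
      - by rewrite inE => /andP[/orP[ij|si] ei]; [left|right];
          apply/existsP; exists i; rewrite ?ij ?si.
      - by move=> ij ei; exists i; rewrite inE ij.
      - by move=> si ei; exists i; rewrite inE si orbT.
    by do 2 case: [exists _, _]; rewrite /= ?uuE.
  exact: (enveloping_mul hT (@cube_formD d) (face1 j) IH).
suff -> : @clift X (nonzero_vertex d) u = face (mem (enum 'I_d)) by [].
apply/funext => -[e x]; rewrite /face /clift /=.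
suff -> : [exists i, (i \in enum 'I_d) && val e i] by [].
by have /existsP[i ei] := valP e; apply/existsP; exists i; rewrite mem_enum.
Qed.

Lemma diag_form_tuple_action (E : choiceType) :
  group_action (tuple_act T Tinv (@diag_form E)).
Proof. exact: tuple_act_action. Qed.

Lemma const_tuple_minimal (E : finType) x :
  minimal_point (Tpow T Tinv) x ->
  minimal_point (tuple_act T Tinv (@diag_form E)) (fun=> x).
Proof.
have hP := @ptws_hausdorff E X hX; have cP := @ptws_compact E X cX.
move=> mx; apply/(minimal_pointP (diag_form_tuple_action E) hP cP) => U oU Ux.
have [V [oV Vx VU]] := box_nbhs oU Ux.
have oW : open (interior (\bigcap_(e in [set: E]) V e)) by exact: open_interior.
have Wx : interior (\bigcap_(e in [set: E]) V e) x.
  have : \forall y \near x, forall e, V e y.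
    by apply: filter_forall => e; apply: open_nbhs_nbhs; split=> //; exact: Vx.
  by apply: filterS => y Vy e _; exact: Vy.
have [K KP] := (minimal_pointP (Tpow_action hT) hX cX x).1 mx _ oW Wx.
exists K => g; have [k kK Wk] := KP g; exists k => //; apply: VU => e.
exact: (interior_subset Wk).
Qed.

(** The constant tuple [x] is minimal for the cube action, so it returns with bounded gaps to the
    open set of tuples that [n0] carries into [V]. Any cube [n] can thus be corrected by a bounded
    [m]. *)
Lemma cube_syndetic d (V : set X) x (n0 : 'I_d -> int) :
  minimal_point (Tpow T Tinv) x -> open V ->
  (forall eps : 'I_d -> bool, (exists i, eps i) -> V (Tpow T Tinv (cube_sum eps n0) x)) ->
  exists M : seq {ffun 'I_d -> int}, forall n : {ffun 'I_d -> int},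
    exists2 m : {ffun 'I_d -> int}, m \in M & forall eps : 'I_d -> bool, (exists i, eps i) ->
      V (Tpow T Tinv (cube_sum eps (fun i => m i + n i)) x).
Proof.
move=> mx oV Vn0.
have mcx := @const_tuple_minimal (nonzero_vertex d) x mx.
have := tuple_minimal_point hT hX cX (@cube_formD d) (@clift_cube d) mcx.
have aG := tuple_act_action hT (@cube_formD d).
pose ffn0 : {ffun 'I_d -> int} := [ffun i => n0 i].
move=> /(minimal_pointP aG (ptws_hausdorff hX) (ptws_compact cX)) /(_
  (tuple_act T Tinv (@cube_form d) ffn0 @^-1` box (fun=> V))) [||K KP].
- by apply: (act_openI aG); apply: box_open.
- move=> e; rewrite /tuple_act.
  have -> : cube_form ffn0 e = cube_sum (val e) n0.
    by apply: eq_bigr => i _; rewrite ffunE.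
  by apply: Vn0; apply/existsP; exact: valP e.
exists [seq ffn0 + k | k <- K] => n; have [k kK Vk] := KP n.
exists (ffn0 + k); first exact: map_f.
move=> eps /existsP eps0.
have epsP : [exists i, [ffun i => eps i] i].
  by have /existsP[i ei] := eps0; apply/existsP; exists i; rewrite ffunE.
have := Vk (exist _ [ffun i => eps i] epsP : nonzero_vertex d).
rewrite /tuple_act -(TpowD hT) -cube_formD.
congr (V (Tpow _ _ _ _)); apply: eq_bigr => i _.
by rewrite /= !ffunE addrA.
Qed.

Lemma tuple_minimal_of_diag (G : zmodType) (E : choiceType) (phi : G -> E -> int)
    (h : int -> G) (x : {ptws E -> X}) :
  (forall g h e, phi (g + h) e = phi g e + phi h e) ->
  (forall n e, phi (h n) e = n) ->
  minimal_point (tuple_act T Tinv (@diag_form E)) x ->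
  minimal_point (tuple_act T Tinv phi) x.
Proof.
move=> phiD hphi; apply: tuple_minimal_point => // u Eu _.
exact: clift_diag hphi Eu.
Qed.

End MinimalTuples.

(** Words in the generators and pairs of integer exponents index the same maps; orbits, minimality
    and transitivity depend only on those maps. *)
Definition same_maps (I J : Type) (Z : Type) (a : I -> Z -> Z) (b : J -> Z -> Z) :=
  (forall i, exists j, a i = b j) /\ (forall j, exists i, a i = b j).

Section SameMaps.
Context (I J : Type) (Z : topologicalType) (a : I -> Z -> Z) (b : J -> Z -> Z).
Hypothesis ab : same_maps a b.

Lemma same_maps_orbit z : orbit a z = orbit b z.
Proof.
apply/seteqP; split=> _ [i _ <-].
  by have [j ->] := ab.1 i; exists j.
by have [j <-] := ab.2 i; exists j.
Qed.

Lemma same_maps_invariant A : invariant a A <-> invariant b A.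
Proof.
split=> iA i z Az.
  by have [j <-] := ab.2 i; exact: iA.
by have [j ->] := ab.1 i; exact: iA.
Qed.

Lemma same_maps_minimal_set A : minimal_set a A <-> minimal_set b A.
Proof.
by split=> -[A0 cA /same_maps_invariant iA minA]; split=> // N NA N0 cN
  /same_maps_invariant iN; exact: minA.
Qed.

Lemma same_maps_minimal_point z : minimal_point a z <-> minimal_point b z.
Proof. by rewrite /minimal_point same_maps_orbit; exact: same_maps_minimal_set. Qed.

Lemma same_maps_diag n : same_maps (diag_act a n) (diag_act b n).
Proof.
split=> i.
  by have [j aibj] := ab.1 i; exists j; rewrite /diag_act aibj.
by have [j aibj] := ab.2 i; exists j; rewrite /diag_act aibj.
Qed.

Lemma same_maps_transitive A :
  topologically_transitive b A -> topologically_transitive a A.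
Proof.
move=> tb U V oU oV UA VA; have [j [z [Uz Vz]]] := tb U V oU oV UA VA.
by have [i aibj] := ab.2 j; exists i, z; rewrite aibj.
Qed.

End SameMaps.

(** * The progression action and its minimality *)

Definition ap_form (d : nat) (g : int * int) (i : 'I_d) : int := g.1 + g.2 * i.+1%:Z.

Lemma ap_formD d (g h : int * int) (i : 'I_d) : ap_form (g + h) i = ap_form g i + ap_form h i.
Proof. by rewrite /ap_form /= mulrDl addrACA. Qed.

Section ProgressionAction.
Context (X : topologicalType) (T Tinv : X -> X).
Hypothesis hT : homeomorphism T Tinv.

Definition ap_act d := tuple_act T Tinv (@ap_form d).

Lemma ap_action d : group_action (@ap_act d).
Proof. exact: (tuple_act_action hT (@ap_formD d)). Qed.

Lemma Tpow_iter_inv n x : iter n Tinv x = Tpow T Tinv (- n%:Z) x.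
Proof. by case: n => // n; rewrite -NegzE. Qed.

(** A word acts through the sum of the exponent pairs of its letters, and powers of the two
    generators reach every pair. *)
Lemma Gd_act_same d : same_maps (@Gd_act X T Tinv d) (@ap_act d).
Proof.
pose genv (g : bool * bool) : int * int :=
  let s : int := if g.2 then -1 else 1 in if g.1 then (0, s) else (s, 0).
have genE g : Gd_gen T Tinv d g = ap_act (genv g).
  apply/funext => z; apply/funext => i; rewrite /Gd_gen /ap_act /tuple_act /ap_form.
  have TE n x : iter n T x = Tpow T Tinv n x by [].
  case: g => -[] []; rewrite [genv _]/= ?Tpow_iter_inv ?TE.
  - by congr Tpow => /=; lia.
  - by congr Tpow => /=; lia.
  - by rewrite -[LHS]/(iter 1 Tinv _) Tpow_iter_inv; congr Tpow => /=; lia.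
  - by rewrite -[LHS]/(iter 1 T _) TE; congr Tpow => /=; lia.
have [a0 aD _] := ap_action d.
have word w : Gd_act T Tinv d w = ap_act (\sum_(g <- w) genv g).
  elim: w => [|g w IH].
    by apply/funext => z; rewrite big_nil a0.
  by apply/funext => z; rewrite big_cons aD /= IH genE.
split=> [w|g]; first by exists (\sum_(g <- w) genv g).
have nat_word (b s : bool) n : \sum_(h <- nseq n (b, s)) genv h = genv (b, s) *+ n.
  by elim: n => [|n IH]; rewrite ?big_nil //= big_cons IH mulrS.
have int_word (b : bool) (n : int) : exists w, \sum_(h <- w) genv h =
    if b then (0, n) else (n, 0).
  case: n => n.
    exists (nseq n (b, false)); rewrite nat_word; case: b; rewrite /genv /=;
      by elim: n => // n IH; rewrite mulrS IH; congr pair => /=; lia.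
  exists (nseq n.+1 (b, true)); rewrite nat_word; case: b; rewrite /genv /=;
    by elim: n => // n IH; rewrite mulrS IH; congr pair => /=; lia.
have [w1 E1] := int_word false g.1; have [w2 E2] := int_word true g.2.
exists (w1 ++ w2); rewrite word big_cat /= E1 E2; congr ap_act.
by case: g {E1 E2} => p q; congr pair => /=; rewrite ?addr0 ?add0r.
Qed.

Lemma ap_act_const d (p q : int) x :
  @ap_act d (p, q) (fun=> x) = fun i : 'I_d => Tpow T Tinv (p + q * i.+1%:Z) x.
Proof. by []. Qed.

End ProgressionAction.

Section Progressions.
Context (X : topologicalType) (T Tinv : X -> X).
Hypotheses (hT : homeomorphism T Tinv) (hX : hausdorff_space X)
  (cX : compact [set: X]) (mX : minimal_set (Tpow T Tinv) [set: X]).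
Variable d : nat.

Lemma minimal_system_point x : minimal_point (Tpow T Tinv) x.
Proof. exact: (minimal_set_point (Tpow_action hT) mX). Qed.

Lemma Nd_const x : Nd T Tinv d (fun=> x).
Proof.
apply: subset_closure; exists x, 0, 0; apply/funext => i.
by rewrite mul0r.
Qed.

(** Since [x] has a dense orbit and the pairs [(n, 0)] move constant tuples along it, the orbit
    closure of one constant tuple contains all constant tuples, hence all progressions. *)
Lemma Nd_orbit_closure x : Nd T Tinv d = closure (orbit (ap_act T Tinv (d := d)) (fun=> x)).
Proof.
have aG := ap_action hT d.
apply/seteqP; split; last first.
  apply: closureS => _ [[p q] _ <-]; exists x, p, q; exact: ap_act_const.
rewrite /Nd [X in closure X `<=` _](_ : _ = \bigcup_y orbit (ap_act T Tinv (d := d)) (fun=> y)).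
  rewrite closureE; apply: smallest_sub; first exact: closed_closure.
  move=> _ [y _ [g _ <-]]; apply: (orbit_closure_invariant aG).
  have clxy : closure (orbit (Tpow T Tinv) x) y.
    by rewrite (minimal_set_closure (Tpow_action hT) mX).
  pose f (x' : X) : {ptws 'I_d -> X} := fun=> x'.
  have cf : continuous f by apply: ptws_continuous => i z; exact: cvg_id.
  have := @closure_image_sub _ _ f (orbit (Tpow T Tinv) x)
    (closure (orbit (ap_act T Tinv (d := d)) (fun=> x))) cf.
  apply=> //; first exact: closed_closure.
  move=> _ [n _ <-].
  apply: subset_closure; exists (n, 0) => //; apply/funext => i.
  by rewrite /ap_act /tuple_act /ap_form /= mul0r addr0.
apply/seteqP; split=> z.
  by move=> [y [p [q ->]]]; exists y => //; exists (p, q).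
by move=> [y _ [[p q] _ <-]]; exists y, p, q.
Qed.

Lemma Nd_minimal : minimal_set (ap_act T Tinv (d := d)) (Nd T Tinv d).
Proof.
have [[x _] _ _ _] := mX; rewrite (Nd_orbit_closure x).
apply: (@tuple_minimal_of_diag _ _ _ hT hX cX _ _ _ (fun n => (n, 0))).
- exact: ap_formD.
- by move=> n i; rewrite /ap_form /= mul0r addr0.
- exact/const_tuple_minimal/minimal_system_point.
Qed.

Lemma Nd_invariant : invariant (ap_act T Tinv (d := d)) (Nd T Tinv d).
Proof. by have [] := Nd_minimal. Qed.

End Progressions.

(** * Progressions under a factor map *)

Section Factor.
Context (X Y : topologicalType) (TX TXinv : X -> X) (TY TYinv : Y -> Y) (pi : X -> Y).
Hypotheses (hX : hausdorff_space X) (cX : compact [set: X]) (hY : hausdorff_space Y)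
  (cpi : continuous pi) (spi : pi @` setT = setT)
  (epi : forall n x, pi (Tpow TX TXinv n x) = Tpow TY TYinv n (pi x)).
Variable d : nat.

Lemma pi_pow_continuous (E : choiceType) :
  continuous (fun (z : {ptws E -> X}) => (fun e => pi (z e)) : {ptws E -> Y}).
Proof.
apply: ptws_continuous => e z; apply: continuous_comp; first exact: ptws_eval_continuous.
exact: cpi.
Qed.

Lemma Nd_map (z : {ptws 'I_d -> X}) : Nd TX TXinv d z -> Nd TY TYinv d (pi_pow pi d z).
Proof.
apply: (@closure_image_sub _ _ (pi_pow pi d)); first exact: pi_pow_continuous.
  exact: closed_closure.
move=> _ [x [p [q ->]]]; apply: subset_closure; exists (pi x), p, q.
by apply/funext => i; rewrite /pi_pow epi.
Qed.

Lemma Nd_lift (y : {ptws 'I_d -> Y}) : Nd TY TYinv d y ->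
  exists2 z, Nd TX TXinv d z & pi_pow pi d z = y.
Proof.
have cl : closed (pi_pow pi d @` Nd TX TXinv d).
  apply: compact_closed; first exact: ptws_hausdorff.
  apply: continuous_compact; first exact/continuous_subspaceT/pi_pow_continuous.
  by apply: (subclosed_compact _ (ptws_compact cX)) => //; exact: closed_closure.
suff : Nd TY TYinv d `<=` pi_pow pi d @` Nd TX TXinv d by move=> h /h[z Nz <-]; exists z.
rewrite {1}/Nd closureE; apply: smallest_sub => // _ [y' [p [q ->]]].
have : (pi @` setT) y' by rewrite spi.
move=> [x _ <-]; exists (fun i => Tpow TX TXinv (p + q * (i.+1)%:Z) x).
  by apply: subset_closure; exists x, p, q.
by apply/funext => i; rewrite /pi_pow epi.
Qed.

End Factor.

(** * Returns along cubes *)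

(** For one map, [X] is covered by the interiors of the sets where the radius [1 / (n + 1)]
    suffices; the largest [n] of a finite subcover gives a common radius. The maps are added one at
    a time. *)
Lemma finite_equicontinuous (R : realType) (X Z : pseudoMetricType R) (I : eqType)
    (f : I -> X -> Z) (s : seq I) (eta : R) :
  compact [set: X] -> (forall i, continuous (f i)) -> 0 < eta ->
  exists2 delta : R, 0 < delta &
    forall i a b, i \in s -> ball a delta b -> ball (f i a) eta (f i b).
Proof.
move=> cX fc eta0; elim: s => [|i s [delta delta0 IH]]; first by exists 1.
pose P (e : R) (a : X) := forall b, ball a e b -> ball (f i a) eta (f i b).
pose U (n : nat) := interior [set a | P n.+1%:R^-1 a].
have [n|a _|t tP] := @finite_subcover X nat setT U cX.
- exact: open_interior.
- have eta2 : 0 < eta / 2 by rewrite divr_gt0.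
  have /nbhs_ballP[e /= e0 eP] : nbhs a (f i @^-1` ball (f i a) (eta / 2)).
    by apply: fc; exact: nbhsx_ballx.
  have e2 : 0 < e / 2 by rewrite divr_gt0.
  have [n] := ltr_add_invr e2; rewrite add0r => ne.
  exists n; apply: (filterS _ (nbhsx_ballx a _ e2)) => b ab c bc.
  have ac : ball a e c by apply: ball_split ab _; apply: le_ball bc; exact: ltW.
  have ab' : ball a e b by apply: le_ball ab; rewrite ler_pdivrMr// ler_pMr// ler1n.
  by apply: (@ball_splitr _ _ (f i a)); exact: eP.
pose N := \max_(n <- t) n.
exists (Num.min N.+1%:R^-1 delta).
  by rewrite lt_min delta0 andbT invr_gt0 ltr0n.
move=> j a b; rewrite inE => /orP[/eqP ->|js] ab; last first.
  by apply: IH => //; apply: le_ball ab; rewrite ge_min lexx orbT.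
have [n nt /interior_subset Pa] := tP a Logic.I; apply: Pa; apply: le_ball ab.
rewrite ge_min lef_pV2 ?posrE ?ltr0n// ler_nat ltnS.
by apply/orP; left; exact: (@leq_bigmax_seq _ t xpredT id n nt isT).
Qed.

Section CubeReturns.
Context (R : realType) (X Y : pseudoMetricType R) (T Tinv : X -> X) (pi : X -> Y).
Hypotheses (hT : homeomorphism T Tinv) (hX : hausdorff_space X)
  (cX : compact [set: X]) (mX : minimal_set (Tpow T Tinv) [set: X])
  (cpi : continuous pi) (opi : forall U, open U -> open (pi @` U))
  (rpi : forall x x', pi x = pi x' -> RPinf T Tinv x x').

Lemma dense_orbit (x : X) (U : set X) : open U -> U !=set0 ->
  exists n, U (Tpow T Tinv n x).
Proof.
move=> oU [u Uu]; have : closure (orbit (Tpow T Tinv) x) u.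
  by rewrite (minimal_set_closure (Tpow_action hT) mX).
move=> /(_ U (open_nbhs_nbhs (conj oU Uu)))[_ [[n _ <-] Un]].
by exists n.
Qed.

Lemma cube_sum_cons d (eps : 'I_d.+1 -> bool) (k : int) (n : 'I_d -> int) :
  cube_sum eps (fun i => if unlift ord0 i is Some j then n j else k) =
  (if eps ord0 then k else 0) + cube_sum (fun i => eps (lift ord0 i)) n.
Proof.
rewrite /cube_sum big_ord_recl unlift_none; congr +%R.
by apply: eq_bigr => i _; rewrite liftK.
Qed.

Lemma nbhs_cube_sum d (V : set X) x (n : 'I_d -> int) :
  open V -> (forall eps : 'I_d -> bool, (exists i, eps i) -> V (Tpow T Tinv (cube_sum eps n) x)) ->
  nbhs x [set x' | forall eps : 'I_d -> bool, (exists i, eps i) ->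
    V (Tpow T Tinv (cube_sum eps n) x')].
Proof.
move=> oV Vn.
have : \forall x' \near x, forall eps : {ffun 'I_d -> bool}, [exists i, eps i] ->
    V (Tpow T Tinv (cube_sum eps n) x').
  apply: (@filter_forall _ _ (fun (eps : {ffun 'I_d -> bool}) x' =>
    [exists i, eps i] -> V (Tpow T Tinv (cube_sum eps n) x')) (nbhs x)) => eps.
  have [/existsP e0|_] := boolP [exists i, eps i].
    have : nbhs (Tpow T Tinv (cube_sum eps n) x) V.
      by apply: open_nbhs_nbhs; split=> //; exact: Vn.
    move=> nV; have := Tpow_continuous hT nV.
    by apply: (@filterS _ (nbhs x)) => x' Vx' _.
  exact: nearW.
apply: filterS => x' Vx' eps [i ei].
have -> : cube_sum eps n = cube_sum [ffun i => eps i] n.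
  by apply: eq_bigr => j _; rewrite ffunE.
by apply: Vx'; apply/existsP; exists i; rewrite ffunE.
Qed.

(** Induction on [d]. On an open set the [d]-cubes of returns provided by induction recur with a
    uniform bound. Regional proximality makes the cubes of nearby points [x'] and [v'] shadow each
    other, a bounded correction puts both in [V], and a time carrying [x'] close to [v'] is the new
    direction. *)
Lemma fibre_cube_returns d (V O : set X) :
  open V -> open O -> O !=set0 -> (forall x, O x -> exists2 v, V v & pi v = pi x) ->
  exists2 x, O x & exists p : 'I_d -> int, forall eps : 'I_d -> bool, (exists i, eps i) ->
    V (Tpow T Tinv (cube_sum eps p) x).
Proof.
elim: d V O => [|d IH] V O oV oO O0 OV.
  by have [x Ox] := O0; exists x => //; exists (fun=> 0) => eps [[]].
have [x0 Ox0] := O0; have [v Vv vx0] := OV _ Ox0.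
have /nbhs_ballP[e /= e0 eV] : nbhs v V by exact: open_nbhs_nbhs.
have e2 : 0 < e / 2 by rewrite divr_gt0.
have e4 : 0 < e / 2 / 2 by rewrite divr_gt0.
pose V1 := interior (ball v (e / 2 / 2)).
have oV1 : open V1 by exact: open_interior.
have V1v : V1 v by exact: nbhsx_ballx.
have clV1 c b : closure V1 c -> ball c (e / 2) b -> V b.
  move=> clc cb; apply: eV; apply: (@ball_split _ _ c) => //.
  have [z [V1z cz]] := clc _ (nbhsx_ballx c _ e4).
  by apply: (@ball_split _ _ z); [exact: interior_subset V1z|exact: ball_sym].
pose O1 := O `&` pi @^-1` (pi @` V1).
have oO1 : open O1.
  by apply: openI => //; move/continuousP: cpi; apply; exact: opi.
have O10 : O1 !=set0 by exists x0; split=> //; exists v.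
have [|x1 O1x1 [p0 Vp0]] := IH V1 O1 oV1 oO1 O10.
  by move=> x [_ [w V1w wx]]; exists w.
pose A := [set x | forall eps : 'I_d -> bool, (exists i, eps i) ->
  V1 (Tpow T Tinv (cube_sum eps p0) x)].
pose O2 := O1 `&` interior A.
have oO2 : open O2 by apply: openI => //; exact: open_interior.
have O20 : O2 !=set0 by exists x1; split=> //; exact: nbhs_cube_sum.
(* [M] bounds the corrections needed; it ranges over a countable type, and taking the closure of
   [V1] makes [E M] closed, as Baire's theorem requires. *)
pose E (M : seq {ffun 'I_d -> int}) := [set x | forall n : {ffun 'I_d -> int},
  exists2 m : {ffun 'I_d -> int}, m \in M & forall eps : 'I_d -> bool, (exists i, eps i) ->
    closure V1 (Tpow T Tinv (cube_sum eps (fun i => m i + n i)) x)].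
have [M|x [_ /interior_subset Ax]|M [W [oW [x Wx] WO2 WE]]] := baire_closed_count (E := E) hX cX oO2 O20.
- have -> : E M = \bigcap_(n in [set: {ffun 'I_d -> int}])
      \bigcup_(m in [set` M]) \bigcap_(eps in [set eps : 'I_d -> bool | exists i, eps i])
        (Tpow T Tinv (cube_sum eps (fun i => m i + n i)) @^-1` closure V1).
    apply/seteqP; split=> z zE n.
      by move=> _; have [m mM mP] := zE n; exists m.
    by have [m mM mP] := zE n I; exists m.
  apply: closed_bigI => n _; apply: closed_bigcup => [|m _]; first exact: finite_seq.
  by apply: closed_bigI => eps _; apply: (act_closedI (Tpow_action hT)); exact: closed_closure.
- have [M MP] := cube_syndetic hT hX cX (minimal_system_point hT mX x) oV1 Ax.
  exists M => n; have [m mM mP] := MP n; exists m => // eps e1.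
  by apply: subset_closure; exact: mP.
have [[Ox [v1 V1v1 v1x]] _] := WO2 _ Wx.
have /nbhs_ballP[dW /= dW0 dWP] : nbhs x W by exact: open_nbhs_nbhs.
have /nbhs_ballP[dV /= dV0 dVP] : nbhs v1 V1 by exact: open_nbhs_nbhs.
pose J := [seq (m, eps) | m <- M, eps <- enum {ffun 'I_d -> bool}].
have [dJ dJ0 dJP] := finite_equicontinuous
  (f := fun j : {ffun 'I_d -> int} * {ffun 'I_d -> bool} => Tpow T Tinv (cube_sum j.2 j.1))
  J cX (fun j => @Tpow_continuous _ _ _ hT _) e2.
pose delta := Num.min dW (Num.min dV dJ).
have delta0 : 0 < delta by rewrite !lt_min dW0 dV0.
have [x' [v' [n [xx' vv' nP]]]] := rpi (esym v1x) d delta0.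
have Wx' : W x' by apply: dWP; apply: le_ball xx'; rewrite ge_min lexx.
have Vv' : V v'.
  apply: (clV1 v') => //; last exact: ballxx.
  apply: subset_closure; apply: dVP; apply: le_ball vv'.
  by rewrite !ge_min lexx orbT.
have [m mM mP] := WE _ Wx' [ffun i => n i].
pose n' (i : 'I_d) := m i + n i.
have mP' (eps : 'I_d -> bool) : (exists i, eps i) -> closure V1 (Tpow T Tinv (cube_sum eps n') x').
  move=> e1; have := mP eps e1; congr (closure V1 (Tpow _ _ _ _)).
  by apply: eq_bigr => i _; rewrite ffunE.
have Vx' (eps : 'I_d -> bool) : (exists i, eps i) -> V (Tpow T Tinv (cube_sum eps n') x').
  by move=> e1; apply: (clV1 _ _ (mP' _ e1)); exact: ballxx.
have Vvn (eps : 'I_d -> bool) : (exists i, eps i) -> V (Tpow T Tinv (cube_sum eps n') v').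
  move=> e1; apply: (clV1 _ _ (mP' _ e1)).
  rewrite !cube_sumD !(TpowD hT).
  have -> : cube_sum eps m = cube_sum [ffun i => eps i] m.
    by apply: eq_bigr => i _; rewrite ffunE.
  apply: (dJP (m, [ffun i => eps i])); last first.
    by apply: le_ball (nP _ e1); rewrite !ge_min lexx !orbT.
  by apply: allpairs_f => //; rewrite mem_enum.
(* The points of [V] whose cube [n'] also stays in [V]: [v'] lies in the interior of this set, so
   the orbit of [x'] reaches [Q] at some time [k]. *)
pose Q := V `&` interior [set z | forall eps : 'I_d -> bool, (exists i, eps i) ->
  V (Tpow T Tinv (cube_sum eps n') z)].
have oQ : open Q by apply: openI => //; exact: open_interior.
have [|k [Vk /interior_subset Qk]] := @dense_orbit x' Q oQ.
  by exists v'; split=> //; exact: nbhs_cube_sum.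
exists x'; first by have [[]] := WO2 _ Wx'.
exists (fun i => if unlift ord0 i is Some j then n' j else k) => eps [i ei].
rewrite cube_sum_cons.
have [[j ej]|nj] := pselect (exists j, eps (lift ord0 j)).
  case: ifP => _; last by rewrite add0r; apply: Vx'; exists j.
  by rewrite addrC (TpowD hT); apply: Qk; exists j.
have -> : cube_sum (fun i => eps (lift ord0 i)) n' = 0.
  by apply: big1 => j _; case: ifP => // ej; case: nj; exists j.
rewrite addr0; case: (unliftP ord0 i) ei => [j ->|->] ei; first by case: nj; exists j.
by rewrite ei.
Qed.

End CubeReturns.

(** By the pigeonhole principle two of the [L + 1] initial partial sums agree modulo [L]; their
    difference is the sum over an interval. *)
Lemma multiple_subset_sum (L : nat) (q : 'I_L -> int) : (0 < L)%N ->
  exists2 S : {set 'I_L}, S != finset.set0 & (L%:Z %| \sum_(k in S) q k)%Z.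
Proof.
case: L q => // L q _; pose s (a : nat) : int := \sum_(k < L.+1 | (k < a)%N) q k.
pose f (a : 'I_L.+2) : 'I_L.+1 := inord `|(s a %% L.+1%:Z)%Z|%N.
have [a [b [ab /= fab]]] : exists a b : 'I_L.+2, (a < b)%N /\ f a = f b.
  have /injectivePn[a [b ab fab]] : ~~ injectiveb f.
    by apply/negP => /injectiveP /leq_card; rewrite !card_ord ltnn.
  case: (ltngtP a b) => [lt|lt|/val_inj eq]; first by exists a, b.
    by exists b, a.
  by rewrite eq eqxx in ab.
have modE (c : 'I_L.+2) : (f c)%:Z = (s c %% L.+1%:Z)%Z.
  have := modz_ge0 (s c) (isT : L.+1%:Z != 0); have := ltz_mod (s c) (isT : L.+1%:Z != 0).
  rewrite /f; case: (s c %% L.+1%:Z)%Z => [m|//] lt _.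
  by rewrite inordK.
exists (finset.finset (fun k : 'I_L.+1 => (a <= k < b)%N)).
  apply/finset.set0Pn; have aL : (a < L.+1)%N by rewrite (leq_trans ab) // -ltnS.
  by exists (Ordinal aL); rewrite inE /= leqnn.
rewrite (_ : \sum_(k in _) q k = s b - s a).
  by rewrite -eqz_mod_dvd -!modE fab.
rewrite /s (bigID (fun k : 'I_L.+1 => (k < a)%N) (fun k : 'I_L.+1 => (k < b)%N)) /=.
rewrite [X in _ = X + _ - _](eq_bigl (fun k : 'I_L.+1 => (k < a)%N)) => [|k].
  rewrite addrC addKr; apply: eq_bigl => k.
  by rewrite inE -leqNgt andbC.
by apply: andb_idl => ka; exact: ltn_trans ka ab.
Qed.

Section FibreReturns.
Context (R : realType) (X Y : pseudoMetricType R) (T Tinv : X -> X) (pi : X -> Y).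
Hypotheses (hT : homeomorphism T Tinv) (hX : hausdorff_space X)
  (cX : compact [set: X]) (mX : minimal_set (Tpow T Tinv) [set: X])
  (cpi : continuous pi) (opi : forall U, open U -> open (pi @` U))
  (rpi : forall x x', pi x = pi x' -> RPinf T Tinv x x').

(** The vertices of a cube are the indicator functions of subsets of its directions. *)
Lemma fibre_set_returns (J : finType) (V O : set X) :
  open V -> open O -> O !=set0 -> (forall x, O x -> exists2 v, V v & pi v = pi x) ->
  exists2 x, O x & exists p : J -> int, forall S : {set J}, S != finset.set0 ->
    V (Tpow T Tinv (\sum_(j in S) p j) x).
Proof.
move=> oV oO O0 OV.
have [x Ox [p pP]] := fibre_cube_returns hT hX cX mX cpi opi rpi #|J| oV oO O0 OV.
exists x => //; exists (fun j => p (enum_rank j)) => S /finset.set0Pn[j jS].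
have := pP (fun i => enum_val i \in S); rewrite /cube_sum -big_mkcond /=.
rewrite (reindex enum_rank) /=; last first.
  by apply: onW_bij; exact: enum_rank_bij.
under eq_bigl do rewrite enum_rankK.
by apply; exists (enum_rank j); rewrite enum_rankK.
Qed.

(** Each generator is a sum over part of a block of [L] generators, chosen divisible by [L]. The
    divisibility later permits division by differences of coordinate indices. *)
Lemma fibre_multiple_returns (r L : nat) (V O : set X) : (0 < L)%N ->
  open V -> open O -> O !=set0 -> (forall x, O x -> exists2 v, V v & pi v = pi x) ->
  exists2 x, O x & exists p : 'I_r -> int, (forall j, (L%:Z %| p j)%Z) /\
    forall S : {set 'I_r}, S != finset.set0 ->
    V (Tpow T Tinv (\sum_(j in S) p j) x).
Proof.
move=> L0 oV oO O0 OV.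
have [x Ox [p pP]] := fibre_set_returns ('I_r * 'I_L)%type oV oO O0 OV.
exists x => //.
have /choice[B BP] : forall j : 'I_r, exists B : {set 'I_L}, B != finset.set0 /\
    (L%:Z %| (\sum_(k in B) p (j, k))%R)%Z.
  by move=> j; have [B B0 BL] := multiple_subset_sum (fun k => p (j, k)) L0; exists B.
exists (fun j => \sum_(k in B j) p (j, k)); split=> [j|S /finset.set0Pn[j jS]].
  by have [] := BP j.
have [/finset.set0Pn[k kB] _] := BP j.
have := pP (finset.finset (fun jk => (jk.1 \in S) && (jk.2 \in B jk.1))).
rewrite (_ : \sum_(jk in _) p jk = \sum_(j in S) \sum_(k in B j) p (j, k)).
  by apply; apply/finset.set0Pn; exists (j, k); rewrite inE /= jS.
by rewrite pair_big_dep /=; apply: eq_big => [jk|[]//]; rewrite inE.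
Qed.

End FibreReturns.

(** * Saturation of progressions *)

Section Saturation.
Context (R : realType) (X Y : pseudoMetricType R) (T Tinv : X -> X) (pi : X -> Y).
Hypotheses (hT : homeomorphism T Tinv) (hX : hausdorff_space X)
  (cX : compact [set: X]) (mX : minimal_set (Tpow T Tinv) [set: X])
  (cpi : continuous pi) (opi : forall U, open U -> open (pi @` U))
  (rpi : forall x x', pi x = pi x' -> RPinf T Tinv x x').
Variable d : nat.

(* The direction of the (p, q)-lattice along which coordinate i0 is fixed. *)
Definition fix_form (i0 : 'I_d) (n : int) (i : 'I_d) : int := n * (i%:Z - i0%:Z).

Lemma fix_formD i0 (m n : int) i : fix_form i0 (m + n) i = fix_form i0 m i + fix_form i0 n i.
Proof. by rewrite /fix_form mulrDl. Qed.

Lemma fix_form_ap i0 n i : fix_form i0 n i = ap_form (- (n * i0.+1%:Z), n) i.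
Proof. rewrite /fix_form /ap_form /=; lia. Qed.

Lemma fix_act_Nd i0 : invariant (tuple_act T Tinv (fix_form i0)) (Nd T Tinv d).
Proof.
move=> n z Nz; have := @Nd_invariant _ _ _ hT hX cX mX d (- (n * i0.+1%:Z), n) _ Nz.
by congr (Nd _ _ _ _); apply/funext => i; rewrite /ap_act /tuple_act fix_form_ap.
Qed.

Lemma closed_box (E : finType) (C : E -> set X) : (forall e, closed (C e)) -> closed (box C).
Proof.
move=> clC; rewrite [box C](_ : _ = \bigcap_(e in [set: E]) ((fun z : {ptws E -> X} => z e) @^-1` C e)).
  apply: closed_bigI => e _; apply: preimage_closed => // z _.
  exact: ptws_eval_continuous.
by apply/seteqP; split=> z h e; [move=> _; exact: h|exact: (h e Logic.I)].
Qed.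

(** The first component of [gK] brings the tuple to the box, the second bounds its gaps between
    returns. Such pairs form a countable type and closures make the set closed, as Baire's theorem
    requires. *)
Definition fix_return_points (i0 : 'I_d) (U : 'I_d -> set X) (gK : (int * int) * seq int) :=
  [set x | exists w : {ptws 'I_d -> X}, [/\ Nd T Tinv d w, w i0 = x & forall n, exists2 m,
    m \in gK.2 & box (fun i => closure (U i))
      (tuple_act T Tinv (fix_form i0) (m + n) (ap_act T Tinv gK.1 w))]].

Lemma fix_return_points_closed i0 U gK : closed (fix_return_points i0 U gK).
Proof.
have aF := tuple_act_action hT (fix_formD i0); have aG := ap_action hT d.
pose B := Nd T Tinv d `&` \bigcap_(n in [set: int]) \bigcup_(m in [set` gK.2])
  (ap_act T Tinv gK.1 @^-1` (tuple_act T Tinv (fix_form i0) (m + n) @^-1`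
    box (fun i => closure (U i)))).
have clB : closed B.
  apply: closedI; first exact: closed_closure.
  apply: closed_bigI => n _; apply: closed_bigcup => [|m _]; first exact: finite_seq.
  apply: (act_closedI aG); apply: (act_closedI aF); apply: closed_box => i.
  exact: closed_closure.
suff -> : fix_return_points i0 U gK = (fun w : {ptws 'I_d -> X} => w i0) @` B.
  apply: compact_closed => //; apply: continuous_compact.
    exact/continuous_subspaceT/ptws_eval_continuous.
  exact: subclosed_compact clB (ptws_compact cX) _.
apply/seteqP; split=> x.
  move=> [w [Nw wx ret]]; exists w => //; split=> // n _.
  by have [m mK mP] := ret n; exists m.
move=> [w [Nw ret] wx]; exists w; split=> // n.
by have [m mK mP] := ret n Logic.I; exists m.
Qed.

(** The points of [N_d(X)] with coordinate [i0] equal to [x] are preserved by the fixing direction,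
    so they include a point minimal for it; minimality of [N_d(X)] gives a [g] carrying that point
    into the box. *)
Lemma fix_return_points_cover i0 (U : 'I_d -> set X) :
  (forall i, open (U i)) -> (Nd T Tinv d `&` box U) !=set0 ->
  forall x, exists gK, fix_return_points i0 U gK x.
Proof.
move=> oU NU x.
have hP := @ptws_hausdorff 'I_d X hX; have cP := @ptws_compact 'I_d X cX.
have aF := tuple_act_action hT (fix_formD i0); have aG := ap_action hT d.
pose C := Nd T Tinv d `&` (fun w : {ptws 'I_d -> X} => w i0) @^-1` [set x].
have [|||M MC mM] := @exists_minimal_set _ _ (tuple_act T Tinv (fix_form i0)) cP C.
- apply: closedI; first exact: closed_closure.
  apply: preimage_closed => [w _|]; first exact: ptws_eval_continuous.
  exact/accessible_closed_set1/hausdorff_accessible.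
- by exists (fun=> x); split=> //; exact: Nd_const.
- move=> n w [Nw wx]; split; first exact: fix_act_Nd.
  by rewrite /= /tuple_act /fix_form subrr mulr0.
have [[w Mw] _ _ _] := mM; have [Nw wx] := MC _ Mw.
have oB := box_open oU.
have [Ks KsP] := minimal_set_syndetic aG cP (Nd_minimal hT hX cX mX d) oB NU.
have [g _ Ug] := KsP w Nw.
have mw := minimal_set_point aF mM Mw.
have [|//|K KP] := (minimal_pointP aF hP cP w).1 mw (ap_act T Tinv g @^-1` box U).
  exact: (act_openI aG).
exists (g, K), w; split=> // n; have [m mK mP] := KP n; exists m => // i.
apply: subset_closure; have := mP i; rewrite /ap_act /tuple_act.
by rewrite -!(TpowD hT) addrC.
Qed.

(** Baire's theorem makes one pair [(g, K)] valid on an open set, and translating by [g] leaves only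
    [K]. *)
Lemma fix_returns i0 (U : 'I_d -> set X) :
  (forall i, open (U i)) -> (Nd T Tinv d `&` box U) !=set0 ->
  exists (K : seq int) (O : set X), [/\ open O, O !=set0 & forall x, O x ->
    exists w : {ptws 'I_d -> X}, [/\ Nd T Tinv d w, w i0 = x & forall n, exists2 m,
    m \in K & box (fun i => closure (U i)) (tuple_act T Tinv (fix_form i0) (m + n) w)]].
Proof.
move=> oU NU; have aG := ap_action hT d.
have [x0 _] : [set: X] !=set0 by have [] := mX.
have [||[g K] [W [oW [x Wx] _ WE]]] :=
  baire_closed_count (E := fix_return_points i0 U) hX cX (@openT X) _
    (@fix_return_points_closed i0 U).
- by exists x0.
- by move=> z _; exact: fix_return_points_cover.
have TW n : Tpow T Tinv (- ap_form g i0) (Tpow T Tinv (ap_form g i0) n) = n.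
  by rewrite -(TpowD hT) addNr.
exists K, (Tpow T Tinv (- ap_form g i0) @^-1` W); split.
- exact: (act_openI (Tpow_action hT)).
- by exists (Tpow T Tinv (ap_form g i0) x); rewrite /= TW.
- move=> y /WE[w [Nw wy ret]]; exists (ap_act T Tinv g w); split=> //.
    exact: (Nd_invariant hT hX cX mX).
  by rewrite /ap_act /tuple_act wy -(TpowD hT) subrr.
Qed.

(* Colouring a word w over 'I_d by a return time of the point displaced along
   the fixing direction by the sum of p_j / (w_j - i0), a monochromatic line
   moves every coordinate i <> i0 by the same amount n = sum of p_j over the
   line's active set, while T^n takes coordinate i0 into V. *)
Lemma Nd_replace_open i0 (U : 'I_d -> set X) (V : set X) :
  (forall i, open (U i)) -> (Nd T Tinv d `&` box U) !=set0 -> open V ->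
  (forall x, closure (U i0) x -> exists2 v, V v & pi v = pi x) ->
  exists2 z : {ptws 'I_d -> X}, Nd T Tinv d z &
    V (z i0) /\ forall i, i != i0 -> closure (U i) (z i).
Proof.
move=> oU NU oV UV.
have [K [O [oO O0 OP]]] := fix_returns i0 oU NU.
have OV x : O x -> exists2 v, V v & pi v = pi x.
  move=> /OP[w [_ <- /(_ 0)[m _ /(_ i0)]]].
  by rewrite /tuple_act /fix_form subrr mulr0 => /UV.
have [r HJ] := hales_jewett [seq i <- enum 'I_d | i != i0] 'I_(size K).
(* All nonzero differences [i - i0] are below [d] in absolute value, hence divide [d!]. *)
have [x Ox [p [pL pV]]] :=
  fibre_multiple_returns hT hX cX mX cpi opi rpi r (fact_gt0 d) oV oO O0 OV.
have [w [Nw wx ret]] := OP x Ox.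
pose q (i : 'I_d) (j : 'I_r) : int := (p j %/ (i%:Z - i0%:Z))%Z.
have qE i j : i != i0 -> q i j * (i%:Z - i0%:Z) = p j.
  move=> ii0; apply: divzK; apply: dvdz_trans (pL j).
  rewrite dvdzE /=; apply: dvdn_fact; apply/andP; split.
    by rewrite absz_gt0 subr_eq0 eqz_nat.
  have := ltn_ord i; have := ltn_ord i0; lia.
pose a (v : seq 'I_d) : int := \sum_(j < r) q (nth i0 v j) j.
have /choice[c cP] : forall v : seq 'I_d, exists k : 'I_(size K),
    box (fun i => closure (U i)) (tuple_act T Tinv (fix_form i0) (K`_k + a v) w).
  move=> v; have [m mK mP] := ret (a v).
  have mK' : (index m K < size K)%N by rewrite index_mem.
  by exists (Ordinal mK'); rewrite /= nth_index.
have [v [k [sv Nv vk]]] := HJ c.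
pose S : {set 'I_r} := finset.finset (fun j : 'I_r => nth None v j == None).
have S0 : S != finset.set0.
  apply/finset.set0Pn; have vr : (index None v < r)%N by rewrite -sv index_mem.
  by exists (Ordinal vr); rewrite inE /= nth_index.
pose n := \sum_(j in S) p j.
(* The fixed letters contribute the same for every substituted letter; off [S] an entry is never
   [None], so [odflt] returns the letter itself. *)
pose a0 := \sum_(j < r | j \notin S) q (odflt i0 (nth None v j)) j.
have aE i : i != i0 -> (a (word_subst i v)) * (i%:Z - i0%:Z) = a0 * (i%:Z - i0%:Z) + n.
  move=> ii0; rewrite /a (bigID (mem S)) /= mulrDl addrC; congr (_ * _ + _).
    apply: eq_bigr => j; rewrite inE => jS.
    have jv : (j < size v)%N by rewrite sv.
    rewrite (nth_map None) //; by case: (nth None v j) jS.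
  rewrite mulr_suml; apply: eq_bigr => j; rewrite inE => /eqP jS.
  have jv : (j < size v)%N by rewrite sv.
  by rewrite (nth_map None) // jS qE.
(* With [m] the return time of colour [k], the exponent of [t] at [i] is [(m + a0) (i - i0) + n]. *)
pose t : int * int := (n - (K`_k + a0) * i0.+1%:Z, K`_k + a0).
exists (ap_act T Tinv t w); first exact: (Nd_invariant hT hX cX mX).
have tE i : ap_form t i = (K`_k + a0) * (i%:Z - i0%:Z) + n.
  rewrite /ap_form /=; lia.
split; first by rewrite /ap_act /tuple_act tE subrr mulr0 add0r wx; exact: pV.
move=> i ii0; have := cP (word_subst i v) i.
rewrite vk; last by rewrite mem_filter ii0 mem_enum.
by rewrite /ap_act /tuple_act tE /fix_form mulrDl aE // addrA -mulrDl.
Qed.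

(** As [N_d(X)] is closed, it suffices to approximate. The neighbourhood of [z] is taken so that in
    coordinate [i0] its closure consists of points whose fibres meet the target [V i0]. *)
Lemma Nd_replace i0 (z : {ptws 'I_d -> X}) x' :
  Nd T Tinv d z -> pi x' = pi (z i0) ->
  Nd T Tinv d (fun i => if i == i0 then x' else z i).
Proof.
move=> Nz x'z; have clN : closed (Nd T Tinv d) by exact: closed_closure.
apply: clN => B /= nB.
move: nB; rewrite nbhsE => -[B' [oB' B'z] B'B].
have [V [oV Vz VB]] := box_nbhs oB' B'z.
have Vx' : V i0 x' by have := Vz i0; rewrite eqxx.
pose P i := if i == i0 then pi @^-1` (pi @` V i0) else V i.
have /choice[U UP] : forall i, exists U, [/\ open U, U (z i) & closure U `<=` P i].
  move=> i; have [oP Pz] : open (P i) /\ P i (z i); last exact: regular_shrink.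
  rewrite /P; case: ifP => [/eqP ->|ii0].
    by split; [move/continuousP: cpi; apply; exact: opi|exists x'].
  by split=> //; have := Vz i; rewrite ii0.
have [||||w Nw [Vw Uw]] := @Nd_replace_open i0 U (V i0).
- by move=> i; have [] := UP i.
- by exists z; split=> // i; have [] := UP i.
- exact: oV.
- move=> x Ux; have [_ _ /(_ x Ux)] := UP i0.
  by rewrite /P eqxx => -[v Vv vx]; exists v.
exists w; split=> //; apply: B'B; apply: VB => i.
have [->//|ii0] := eqVneq i i0.
by have [_ _ /(_ _ (Uw i ii0))] := UP i; rewrite /P (negbTE ii0).
Qed.

Lemma Nd_fibre (z z' : {ptws 'I_d -> X}) :
  Nd T Tinv d z -> (forall i, pi (z' i) = pi (z i)) -> Nd T Tinv d z'.
Proof.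
move=> Nz zz'.
suff H (s : seq 'I_d) : Nd T Tinv d (fun i => if i \in s then z' i else z i).
  have := H (enum 'I_d); congr (Nd _ _ _ _); apply/funext => i.
  by rewrite mem_enum.
elim: s => [//|j s IH].
have := @Nd_replace j _ (z' j) IH.
rewrite (_ : (fun i => _) = (fun i => if i \in j :: s then z' i else z i)).
  by apply; case: ifP => // _; exact: zz'.
by apply/funext => i; rewrite inE; case: eqP => [->|].
Qed.

End Saturation.

(** * Relatively incontractible powers *)

Section DiagonalActions.
Context (G : zmodType) (Z : topologicalType) (a : G -> Z -> Z).
Hypothesis aG : group_action a.

Lemma diag_act_action n : group_action (diag_act a n).
Proof.
have [a0 aD ac] := aG; split=> [z|g h z|g].
- by apply/funext => k; exact: a0.
- by apply/funext => k; exact: aD.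
apply: ptws_continuous => k z; apply: (@continuous_comp _ _ _ (fun z : {ptws 'I_n -> Z} => z k)).
  exact: ptws_eval_continuous.
exact: ac.
Qed.

Lemma minimal_point_act g z :
  minimal_point a z -> minimal_point a (a g z).
Proof.
move=> mz; apply: (minimal_set_point aG mz).
by apply: subset_closure; exists g.
Qed.

Lemma minimal_point_image (W : topologicalType) (b : G -> W -> W) (f : Z -> W) z :
  group_action b -> hausdorff_space Z -> compact [set: Z] ->
  hausdorff_space W -> compact [set: W] ->
  continuous f -> (forall g z, f (a g z) = b g (f z)) ->
  minimal_point a z -> minimal_point b (f z).
Proof.
move=> bG hZ cZ hW cW cf fab mz.
apply/(minimal_pointP bG hW cW) => U oU Ufz.
have [|//|K KP] := (minimal_pointP aG hZ cZ z).1 mz (f @^-1` U).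
  by move/continuousP: cf; apply.
by exists K => g; have [k kK Uk] := KP g; exists k => //; rewrite -fab.
Qed.

End DiagonalActions.

Section RICPowers.
Context (R : realType) (X Y : pseudoMetricType R)
  (TX TXinv : X -> X) (TY TYinv : Y -> Y) (pi : X -> Y).
Hypotheses (hX : hausdorff_space X) (cX : compact [set: X])
  (hY : hausdorff_space Y) (cY : compact [set: Y])
  (hTX : homeomorphism TX TXinv) (hTY : homeomorphism TY TYinv)
  (mX : minimal_set (Tpow TX TXinv) [set: X])
  (mY : minimal_set (Tpow TY TYinv) [set: Y])
  (rpi : forall x x', pi x = pi x' -> RPinf TX TXinv x x')
  (ric : RIC (Tpow TX TXinv) (Tpow TY TYinv) [set: X] [set: Y] pi).
Variable d : nat.

Let cpi : continuous pi.
Proof. by have [[cpi _ _] _ _] := ric; exact/continuous_subspace_setT. Qed.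

Let spi : pi @` setT = setT.
Proof. by have [[]] := ric. Qed.

Let epi n x : pi (Tpow TX TXinv n x) = Tpow TY TYinv n (pi x).
Proof. by have [[_ _ epi] _ _] := ric; exact: epi. Qed.

Let opi U : open U -> open (pi @` U).
Proof.
have [_ opi _] := ric; move=> /opi[V [oV]].
by rewrite !setIT => ->.
Qed.

Lemma Nd_preimage (z : {ptws 'I_d -> X}) :
  Nd TX TXinv d z <-> Nd TY TYinv d (pi_pow pi d z).
Proof.
split; first exact: Nd_map.
move=> /(Nd_lift cX hY cpi spi epi)[z0 Nz0 z0z].
apply: (Nd_fibre hTX hX cX mX cpi opi rpi Nz0) => i.
by have /(congr1 (fun f : {ptws 'I_d -> Y} => f i)) := z0z.
Qed.

Lemma pi_pow_open (U : set {ptws 'I_d -> X}) : open U -> open (pi_pow pi d @` U).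
Proof.
move=> oU; apply: openP_nbhs => _ [z Uz <-].
have [V [oV Vz VU]] := box_nbhs oU Uz.
exists (box (fun i => pi @` V i)); split.
- by apply: box_open => i; exact: opi.
- by move=> i; exists (z i) => //; exact: Vz.
move=> y yV; have /choice[x xP] : forall i, exists x, V i x /\ pi x = y i.
  by move=> i; have [x Vx xy] := yV i; exists x.
exists (x : {ptws 'I_d -> X}); first by apply: VU => i; have [] := xP i.
by apply/funext => i; have [] := xP i.
Qed.

Lemma pi_pow_open_onto : open_onto (Nd TX TXinv d) (Nd TY TYinv d) (pi_pow pi d).
Proof.
move=> U oU; exists (pi_pow pi d @` U); split; first exact: pi_pow_open.
apply/seteqP; split=> [_ [z [Uz Nz] <-]|_ [[z Uz <-] Nz]].
  by split; [exists z|exact/Nd_preimage].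
by exists z => //; split=> //; exact/Nd_preimage.
Qed.

Lemma pi_pow_ap_act g (z : {ptws 'I_d -> X}) :
  pi_pow pi d (ap_act TX TXinv g z) = ap_act TY TYinv g (pi_pow pi d z).
Proof. by apply/funext => i; exact: epi. Qed.

Lemma pi_pow_Gd_act w (z : {ptws 'I_d -> X}) :
  pi_pow pi d (Gd_act TX TXinv d w z) = Gd_act TY TYinv d w (pi_pow pi d z).
Proof.
elim: w => //= -[b s] w <-; apply/funext => i; rewrite /pi_pow /Gd_gen /=.
have piT x : pi (TX x) = TY (pi x) by exact: (epi 1).
have piTi x : pi (TXinv x) = TYinv (pi x) by exact: (epi (-1)).
have piS n x : pi (iter n (if s then TXinv else TX) x) =
    iter n (if s then TYinv else TY) (pi x).
  by elim: n => //= n <-; case: s.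
by case: b; [exact: (piS i.+1)|exact: (piS 1%N)].
Qed.

Lemma pi_pow_extension : extension (Gd_act TX TXinv d) (Gd_act TY TYinv d)
  (Nd TX TXinv d) (Nd TY TYinv d) (pi_pow pi d).
Proof.
split.
- exact/continuous_subspaceT/pi_pow_continuous.
- apply/seteqP; split=> [_ [z /Nd_preimage Nz <-] //|y].
  by move=> /(Nd_lift cX hY cpi spi epi)[z Nz <-]; exists z.
- by move=> w z _; exact: pi_pow_Gd_act.
Qed.

(** The tuples are approximated over a genuine progression of one point [y0]. The [n d] coordinates
    are pulled back by powers of [T] into the fibre of [y0], approximated there by a [T]-minimal
    tuple in some fibre of [pi], and pushed forward again. *)
Lemma pi_pow_minimal_dense n : (1 <= n)%N -> (1 <= d)%N ->
  fibre_power (pi_pow pi d) (Nd TX TXinv d) n `<=`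
  closure ([set x | minimal_point (diag_act (ap_act TX TXinv (d := d)) n) x] `&`
    fibre_power (pi_pow pi d) (Nd TX TXinv d) n).
Proof.
move=> n0 d0 x [Nx xx] B; rewrite nbhsE => -[B' [oB' B'x] B'B].
have [V [oV Vx VB]] := box_nbhs oB' B'x.
have /choice[U UP] : forall k, exists U : 'I_d -> set X,
    [/\ forall i, open (U i), box U (x k) & box U `<=` V k].
  by move=> k; exact: (box_nbhs (oV k) (Vx k)).
pose k0 := Ordinal n0; pose i0 := Ordinal d0.
pose y := pi_pow pi d (x k0); have Ny : Nd TY TYinv d y by apply/Nd_preimage.
pose W i := interior [set y' | forall k, (pi @` U k i) y'].
have Wy : box W y.
  move=> i; apply: (@filter_forall _ _ (fun k y' => (pi @` U k i) y') (nbhs (y i))) => k.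
  apply: open_nbhs_nbhs; split; first by apply: opi; have [] := UP k.
  exists (x k i); first by have [_ + _] := UP k; apply.
  by have /(congr1 (fun f : {ptws 'I_d -> Y} => f i)) := xx k k0.
have [|_ [[y0 [p [q ->]]] Wy0]] := Ny (box W).
  by apply: open_nbhs_nbhs; split=> //; apply: box_open => i; exact: open_interior.
have /choice[u uP] : forall e : 'I_n * 'I_d, exists u, U e.1 e.2 u /\
    pi u = Tpow TY TYinv (ap_form (p, q) e.2) y0.
  by move=> [k i]; have /interior_subset /(_ k)[u Uu uy] := Wy0 i; exists u.
pose m := #|{: 'I_n * 'I_d}|.
have m0 : (1 <= m)%N by apply/card_gt0P; exists (k0, i0).
pose s (e : 'I_m) := ap_form (p, q) (enum_val e).2.
pose v : {ptws 'I_m -> X} := fun e => Tpow TX TXinv (- s e) (u (enum_val e)).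
have Fv : fibre_power pi setT m v.
  have vy e : pi (v e) = y0.
    rewrite /v epi; have [_ ->] := uP (enum_val e).
    by rewrite -(TpowD hTY) addNr.
  by split=> // e e'; rewrite !vy.
have [_ _ /(_ m m0 v Fv)] := ric.
move=> /(_ (box (fun e => Tpow TX TXinv (s e) @^-1` U (enum_val e).1 (enum_val e).2))) [].
  apply: open_nbhs_nbhs; split.
    apply: box_open => e; apply: (act_openI (Tpow_action hTX)).
    by have [] := UP (enum_val e).1.
  move=> e; rewrite /v /= -(TpowD hTX) subrr.
  by have [] := uP (enum_val e).
move=> w [[mw [_ ww]] Uw].
(* Each coordinate keeps the progression exponent of its position; the pairs [(n, 0)] act
   diagonally, so diagonal minimality of [w] passes to this action. *)
pose phi (g : int * int) (e : 'I_m) := ap_form g (enum_val e).2.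
have phiD g h e : phi (g + h) e = phi g e + phi h e by exact: ap_formD.
have aE := tuple_act_action hTX phiD.
have mw' : minimal_point (tuple_act TX TXinv phi) w.
  apply: (@tuple_minimal_of_diag _ _ _ hTX hX cX _ _ phi (fun n => (n, 0))) => //.
  by move=> l e; rewrite /phi /ap_form /= mul0r addr0.
pose F (w : {ptws 'I_m -> X}) : {ptws 'I_n -> {ptws 'I_d -> X}} :=
  fun k i => w (enum_rank (k, i)).
exists (F (tuple_act TX TXinv phi (p, q) w)); split; last first.
  apply: B'B; apply: VB => k; have [_ _] := UP k; apply => i.
  by have := Uw (enum_rank (k, i)); rewrite /F /tuple_act /phi /s enum_rankK.
split; last first.
  have FE k i : pi (F (tuple_act TX TXinv phi (p, q) w) k i) =
      Tpow TY TYinv (ap_form (p, q) i) (pi (w (enum_rank (k0, i0)))).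
    rewrite /F /tuple_act /phi enum_rankK epi; congr (Tpow _ _ _ _).
    exact: ww.
  split=> [k|k l]; last by apply/funext => i; rewrite /pi_pow !FE.
  apply/Nd_preimage.
  have -> : pi_pow pi d (F (tuple_act TX TXinv phi (p, q) w) k) =
    ap_act TY TYinv (p, q) (fun=> pi (w (enum_rank (k0, i0)))).
    by apply/funext => i; rewrite /pi_pow FE.
  by apply: (Nd_invariant hTY hY cY mY); exact: Nd_const.
apply: (@minimal_point_image _ _ (tuple_act TX TXinv phi) aE _ _ F).
- exact/diag_act_action/ap_action.
- exact: ptws_hausdorff.
- exact: ptws_compact.
- exact/ptws_hausdorff/ptws_hausdorff.
- exact/ptws_compact/ptws_compact.
- apply: ptws_continuous => k; apply: ptws_continuous => i.
  exact: ptws_eval_continuous.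
- move=> g w'; apply/funext => k; apply/funext => i.
  by rewrite /F /tuple_act /phi enum_rankK.
- exact: minimal_point_act.
Qed.

Lemma pi_pow_RIC : (1 <= d)%N ->
  RIC (Gd_act TX TXinv d) (Gd_act TY TYinv d) (Nd TX TXinv d) (Nd TY TYinv d)
    (pi_pow pi d).
Proof.
move=> d0; split; [exact: pi_pow_extension|exact: pi_pow_open_onto|move=> n n0].
apply: subset_trans (pi_pow_minimal_dense n0 d0) _; apply: closureS => z [mz Fz].
split=> //; apply/(same_maps_minimal_point (same_maps_diag (Gd_act_same hTX d) n)).
exact: mz.
Qed.

End RICPowers.

(** * Weakly mixing powers *)

Section WeaklyMixingPowers.
Context (R : realType) (X Y : pseudoMetricType R)
  (TX TXinv : X -> X) (TY TYinv : Y -> Y) (pi : X -> Y).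
Hypotheses (hX : hausdorff_space X) (cX : compact [set: X])
  (hY : hausdorff_space Y) (cY : compact [set: Y])
  (hTX : homeomorphism TX TXinv) (hTY : homeomorphism TY TYinv)
  (mX : minimal_set (Tpow TX TXinv) [set: X])
  (mY : minimal_set (Tpow TY TYinv) [set: Y])
  (rpi : forall x x', pi x = pi x' -> RPinf TX TXinv x x')
  (ric : RIC (Tpow TX TXinv) (Tpow TY TYinv) [set: X] [set: Y] pi)
  (wm : topologically_transitive (diag_act (Tpow TX TXinv) 2)
    (fibre_power pi [set: X] 2)).
Variable d : nat.
Hypothesis d0 : (1 <= d)%N.

Let cpi : continuous pi.
Proof. by have [[cpi _ _] _ _] := ric; exact/continuous_subspace_setT. Qed.

Let epi n x : pi (Tpow TX TXinv n x) = Tpow TY TYinv n (pi x).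
Proof. by have [[_ _ epi] _ _] := ric; exact: epi. Qed.

Let opi U : open U -> open (pi @` U).
Proof.
have [_ opi _] := ric; move=> /opi[V [oV]].
by rewrite !setIT => ->.
Qed.

Let P := fibre_power (pi_pow pi d) (Nd TX TXinv d) 2.

Let act := diag_act (ap_act TX TXinv (d := d)) 2.

Let Z := {ptws 'I_2 -> {ptws 'I_d -> X}}.

Let aG : group_action act.
Proof. exact/diag_act_action/ap_action. Qed.

Let hZ : hausdorff_space Z.
Proof. exact/ptws_hausdorff/ptws_hausdorff. Qed.

Let cZ : compact [set: Z].
Proof. exact/ptws_compact/ptws_compact. Qed.

Let pair_box (U : 'I_2 * 'I_d -> set X) : set Z := [set z | forall e, U e (z e.1 e.2)].

Let pair_box_open U : (forall e, open (U e)) -> open (pair_box U).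
Proof.
move=> oU; rewrite (_ : pair_box U = box (fun k => box (fun i => U (k, i)))).
  by apply: box_open => k; apply: box_open => i; exact: oU.
by apply/seteqP; split=> z Uz; [move=> k i; exact: (Uz (k, i))|move=> [k i]; exact: Uz].
Qed.

Let pair_box_nbhs (z : Z) (B : set Z) : open B -> B z ->
  exists U, [/\ forall e, open (U e), pair_box U z & pair_box U `<=` B].
Proof.
move=> oB Bz; have [V [oV Vz VB]] := box_nbhs oB Bz.
have /choice[U UP] : forall k, exists U : 'I_d -> set X,
    [/\ forall i, open (U i), box U (z k) & box U `<=` V k].
  by move=> k; exact: (box_nbhs (oV k) (Vz k)).
exists (fun e => U e.1 e.2); split.
- by move=> e; have [] := UP e.1.
- by move=> e; have [_ + _] := UP e.1; apply.
- move=> z' Uz'; apply: VB => k; have [_ _] := UP k; apply => i.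
  exact: (Uz' (k, i)).
Qed.

Let eval (e : 'I_2 * 'I_d) (z : Z) : X := z e.1 e.2.

Let eval_continuous e : continuous (eval e).
Proof.
move=> z; apply: (@continuous_comp _ _ _ (fun z : Z => z e.1)
  (fun z : {ptws 'I_d -> X} => z e.2)); exact: ptws_eval_continuous.
Qed.

(** By saturation, membership in the relation depends only on the images in [Y]; coordinates may
    then be changed freely inside their fibres. *)
Let fibre_pairP (z : Z) : P z <->
  (forall k i, pi (z k i) = pi (z ord0 i)) /\ Nd TY TYinv d (pi_pow pi d (z ord0)).
Proof.
have NP := Nd_preimage hX cX hY hTX mX rpi ric.
split=> [[Nz zz]|[zz Nz]].
  split; last exact/NP.
  by move=> k i; have /(congr1 (fun f : {ptws 'I_d -> Y} => f i)) := zz k ord0.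
have zE k : pi_pow pi d (z k) = pi_pow pi d (z ord0) by apply/funext => i; exact: zz.
by split=> [k|k l]; rewrite ?zE//; apply/NP; rewrite zE.
Qed.

Let fibre_pair_replace (z : Z) e0 x : P z -> pi x = pi (eval e0 z) ->
  P (fun k i => if (k, i) == e0 then x else z k i).
Proof.
move=> /fibre_pairP[zz Nz] xz; apply/fibre_pairP.
have zE k i : pi (if (k, i) == e0 then x else z k i) = pi (z k i).
  by case: eqP => // ke; rewrite xz -ke.
split=> [k i|]; first by rewrite !zE zz.
rewrite (_ : pi_pow _ _ _ = pi_pow pi d (z ord0)) //.
by apply/funext => i; rewrite /pi_pow zE.
Qed.

Let fibre_pair_invariant : invariant act P.
Proof.
move=> g z /fibre_pairP[zz Nz]; apply/fibre_pairP; split=> [k i|].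
  by rewrite /act /diag_act /ap_act /tuple_act !epi zz.
rewrite /act /diag_act (pi_pow_ap_act ric).
exact: (Nd_invariant hTY hY cY mY).
Qed.

Let fibre_pair_closed : closed P.
Proof.
have -> : P = \bigcap_(k in [set: 'I_2]) ((fun z : Z => z k) @^-1` Nd TX TXinv d) `&`
    \bigcap_(k in [set: 'I_2]) [set z : Z | pi_pow pi d (z k) = pi_pow pi d (z ord0)].
  apply/seteqP; split=> z.
    by move=> [Nz zz]; split=> [k _|k _]; [exact: Nz|exact: zz].
  move=> [Nz zz]; split=> [k|k l]; first exact: (Nz k Logic.I).
  by have /= -> := zz k Logic.I; have /= -> := zz l Logic.I.
apply: closedI; apply: closed_bigI => k _.
  apply: preimage_closed => [z _|]; first exact: ptws_eval_continuous.
  exact: closed_closure.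
move=> z clz; apply/funext => i.
have hYi := hY; apply: hYi; move=> A B nA nB.
have c1 := @eval_continuous (k, i) z; have c2 := @eval_continuous (ord0, i) z.
have nA' : nbhs z ((fun z : Z => pi (z k i)) @^-1` A).
  have nA1 : nbhs (eval (k, i) z) (pi @^-1` A) by exact: (cpi nA).
  exact: (c1 _ nA1).
have nB' : nbhs z ((fun z : Z => pi (z ord0 i)) @^-1` B).
  have nB1 : nbhs (eval (ord0, i) z) (pi @^-1` B) by exact: (cpi nB).
  exact: (c2 _ nB1).
have [w [/(congr1 (fun f : {ptws 'I_d -> Y} => f i)) ww [Aw Bw]]] := clz _ (filterI nA' nB').
by exists (pi (w k i)); split=> //; move: ww; rewrite /pi_pow => ->.
Qed.

Let saturated (A : set X) := forall x x', pi x = pi x' -> A x -> A x'.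

(** The side at [e0] is enlarged to all fibres meeting it, which frees coordinate [e0] within its
    fibre. *)
Let fibre_hull (U : 'I_2 * 'I_d -> set X) e0 e : set X :=
  if e == e0 then pi @^-1` (pi @` U e0) else U e.

Let fibre_hull_open U e0 : (forall e, open (U e)) -> forall e, open (fibre_hull U e0 e).
Proof.
move=> oU e; rewrite /fibre_hull; case: ifP => // _.
by move/continuousP: cpi; apply; exact: opi.
Qed.

Let fibre_hull_sub U e0 : pair_box U `<=` pair_box (fibre_hull U e0).
Proof.
move=> z Uz e; rewrite /fibre_hull; case: eqP => [->|_]; last exact: Uz.
by exists (z e0.1 e0.2).
Qed.

Let fibre_hull_saturated U e0 (s : seq ('I_2 * 'I_d)) :
  (forall e, e \notin e0 :: s -> saturated (U e)) ->
  forall e, e \notin s -> saturated (fibre_hull U e0 e).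
Proof.
move=> sU e es; rewrite /fibre_hull; case: eqP => [_|/eqP ee0].
  by move=> x x' xx' [u Uu ux]; exists u => //; rewrite ux.
by apply: sU; rewrite inE negb_or ee0.
Qed.

(* M is the orbit closure of a minimal m in P near U with act g0 m near B.
   Coordinate e0 of the points of M near B covers an open set of X; there the
   transitivity of R_pi yields w in M and b in B e0 over w e0 whose e0-orbits
   come close at some time, and a bounded further time returns w to U. *)
Let pair_transitive_step (U B : 'I_2 * 'I_d -> set X) e0 g0 (z : Z) :
  (forall e, open (U e)) -> (forall e, open (B e)) ->
  P z -> pair_box U z -> pair_box (fibre_hull B e0) (act g0 z) ->
  exists g z, [/\ P z, pair_box U z & pair_box B (act g z)].
Proof.
move=> oU oB Pz Uz Bz.
have oO : open (pair_box U `&` act g0 @^-1` pair_box (fibre_hull B e0)).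
  apply: openI; first exact: pair_box_open.
  by apply: (act_openI aG); apply: pair_box_open; exact: fibre_hull_open.
have [m [[mm Pm] [Um Bm]]] := pi_pow_minimal_dense hX cX hY cY hTX hTY mX mY rpi ric
  (isT : (1 <= 2)%N) d0 Pz (open_nbhs_nbhs (conj oO (conj Uz Bz))).
pose M := closure (orbit act m).
have mM : minimal_set act M := mm.
have Mm : M m by apply: subset_closure; exact: orbit_self.
have MP : M `<=` P.
  exact: (@orbit_closure_sub _ _ act P m fibre_pair_closed fibre_pair_invariant Pm).
have [_ _ iM _] := mM.
have /nbhs_ballP[e /= e_gt0 eU] : nbhs (eval e0 m) (U e0).
  by apply: open_nbhs_nbhs; split=> //; exact: Um.
have e2 : 0 < e / 2 by rewrite divr_gt0.
pose U' f := if f == e0 then interior (ball (eval e0 m) (e / 2)) else U f.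
have oU' f : open (U' f) by rewrite /U'; case: ifP => // _; exact: open_interior.
have U'm : pair_box U' m.
  move=> f; rewrite /U'; case: eqP => [->|_]; last exact: Um.
  exact: nbhsx_ballx.
have [K KP] := minimal_set_syndetic aG cZ mM (pair_box_open oU')
  (ex_intro _ m (conj Mm U'm)).
(* Points within [delta] stay within [e / 2] under all the bounded return times in [K]. *)
have [delta delta0 deltaP] := finite_equicontinuous (f := Tpow TX TXinv)
  [seq ap_form k e0.2 | k <- K] cX (@Tpow_continuous _ _ _ hTX) e2.
have /choice[B' B'P] : forall f, exists V, [/\ open V, V (eval f (act g0 m)) &
    closure V `<=` fibre_hull B e0 f].
  by move=> f; apply: regular_shrink; [| |exact: fibre_hull_open|exact: (Bm f)].
have oB' : open (pair_box B') by apply: pair_box_open => f; have [] := B'P f.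
pose Q := M `&` pair_box (fun f => closure (B' f)).
have clQ : closed Q.
  apply: closedI; first exact: closed_closure.
  rewrite (_ : pair_box _ = \bigcap_(f in [set: 'I_2 * 'I_d]) (eval f @^-1` closure (B' f))).
    apply: closed_bigI => f _; apply: preimage_closed => [w _|]; first exact: eval_continuous.
    exact: closed_closure.
  by apply/seteqP; split=> w Bw f; [move=> _; exact: Bw|exact: (Bw f Logic.I)].
have closed_proj (A : set Z) : closed A -> closed (eval e0 @` A).
  move=> clA; apply: compact_closed => //; apply: continuous_compact.
    exact/continuous_subspaceT/eval_continuous.
  exact: subclosed_compact clA cZ _.
(* The projection of [M] is closed and [T]-invariant, so it is [X] by minimality. *)
have MX : eval e0 @` M = setT.
  have [_ _ _ minX] := mX; apply: minX => //.
  - by exists (eval e0 m); exists m.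
  - by apply: closed_proj; exact: closed_closure.
  - move=> n _ [w Mw <-]; exists (act (n, 0) w); first exact: iM.
    by rewrite /eval /act /diag_act /ap_act /tuple_act /ap_form /= mul0r addr0.
have [K2 K2P] := minimal_set_syndetic aG cZ mM oB'
  (ex_intro _ (act g0 m) (conj (iM _ _ Mm) (fun f => let: And3 _ h _ := B'P f in h))).
have [x00 _] : [set: X] !=set0 by have [] := mX.
(* Finitely many closed sets cover [X], so one has interior points; a translate gives an open set
   inside the projection of [Q]. *)
have [|||k _ [x1 Wx1]] := @finite_closed_interior X _ K2
    (fun k => Tpow TX TXinv (ap_form k e0.2) @^-1` (eval e0 @` Q)) setT (@openT X).
- by exists x00.
- by move=> k; apply: (act_closedI (Tpow_action hTX)); exact: closed_proj.
- move=> x _; have : (eval e0 @` M) x by rewrite MX.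
  move=> [w Mw <-]; have [k kK2 Bk] := K2P w Mw; exists k => //.
  by exists (act k w) => //; split; [exact: iM|move=> f; apply: subset_closure; exact: Bk].
pose O := Tpow TX TXinv (- ap_form k e0.2) @^-1`
  interior (Tpow TX TXinv (ap_form k e0.2) @^-1` (eval e0 @` Q)).
have oO' : open O by apply: (act_openI (Tpow_action hTX)); exact: open_interior.
have OQ x : O x -> (eval e0 @` Q) x.
  by move=> /interior_subset /=; rewrite -(TpowD hTX) subrr.
pose x2 := Tpow TX TXinv (ap_form k e0.2) x1.
have Ox2 : O x2 by rewrite /O /x2 /= -(TpowD hTX) addNr.
have QB w : Q w -> forall f, fibre_hull B e0 f (eval f w).
  by move=> [_ Bw] f; have [_ _] := B'P f; apply; exact: Bw.
have [b Bb bx2] : exists2 b, B e0 b & pi b = pi x2.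
  by have [w /QB /(_ e0) + <-] := OQ _ Ox2; rewrite /fibre_hull eqxx => -[b Bb bw]; exists b.
pose D := interior (ball x2 (delta / 2)).
have dlt2 : 0 < delta / 2 by rewrite divr_gt0.
(* Transitivity of [R_pi] starts from [O] and [B e0], which contain the fibre pair [(x2, b)], and
   aims at the diagonal pair [(x2, x2)], so that the two ends come within [delta]. *)
pose start (j : 'I_2) := if j == ord0 then O else B e0.
have [||||n [r [[Sr [_ rr]] [Dr _]]]] := wm (U := box start) (V := box (fun=> D)).
- by apply: box_open => j; rewrite /start; case: ifP.
- by apply: box_open => j; exact: open_interior.
- exists (fun j : 'I_2 => if j == ord0 then x2 else b); split.
    by move=> j; rewrite /start; case: ifP.
  by split=> // j l; do 2 case: ifP.
- exists (fun=> x2); split=> // j; exact: nbhsx_ballx.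
have Or : O (r ord0) by have := Sr ord0.
have Br : B e0 (r ord_max) by have := Sr ord_max.
have rn : ball (Tpow TX TXinv n (r ord0)) delta (Tpow TX TXinv n (r ord_max)).
  apply: (@ball_splitr _ _ x2); first exact: (interior_subset (Dr ord0)).
  exact: (interior_subset (Dr ord_max)).
have [w Qw wr] := OQ _ Or.
have Mw : M w by have [] := Qw.
(* Replacing coordinate [e0] of [w] puts the point in [B]; at time [n] it is close to the orbit of
   [w], which [k'] returns to [U]. The transition from [U] to [B] is then the inverse of this
   motion. *)
pose w' : Z := fun j i => if (j, i) == e0 then r ord_max else w j i.
have Pw' : P w'.
  by apply: fibre_pair_replace; [exact: MP|rewrite wr; exact: rr].
have [k' k'K Uk'] := KP (act (n, 0) w) (iM _ _ Mw).
have [a0 aD _] := aG.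
exists (- (k' + (n, 0))), (act (k' + (n, 0)) w'); split.
- exact: fibre_pair_invariant.
- move=> f; have := Uk' f; rewrite -aD /U' /act /diag_act /ap_act /tuple_act /w'.
  rewrite -surjective_pairing; case: eqP => [->|//] /interior_subset mk.
  have E : ap_form (k' + (n, 0)) e0.2 = ap_form k' e0.2 + n.
    by rewrite ap_formD [X in _ + X]/ap_form /= mul0r addr0.
  apply: eU; apply: (ball_split mk); rewrite E !(TpowD hTX (ap_form k' e0.2) n).
  apply: deltaP; first by apply/mapP; exists k'.
  by have -> : w e0.1 e0.2 = r ord0.
- rewrite (act_addK aG) => f; rewrite /w' -surjective_pairing.
  have [->//|fe0] := eqVneq f e0.
  by have := QB _ Qw f; rewrite /fibre_hull (negbTE fe0).
Qed.

(** Induction on the coordinates whose sides may fail to be saturated. With none left, the question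
    lives in [Y], where minimality of [N_d(Y)] answers it. Otherwise the sides of [U] and [B] at
    [e0] are enlarged to hulls; afterwards [z] is corrected within its fibre for [U], and the
    preceding step recovers [B]. *)
Let pair_transitive (s : seq ('I_2 * 'I_d)) (U B : 'I_2 * 'I_d -> set X) :
  (forall e, open (U e)) -> (forall e, open (B e)) ->
  (forall e, e \notin s -> saturated (U e)) ->
  (forall e, e \notin s -> saturated (B e)) ->
  (P `&` pair_box U) !=set0 -> (P `&` pair_box B) !=set0 ->
  exists g z, [/\ P z, pair_box U z & pair_box B (act g z)].
Proof.
elim: s U B => [|e0 s IH] U B oU oB sU sB [u [Pu Uu]] [b [Pb Bb]].
  have /fibre_pairP[uu Nu] := Pu; have /fibre_pairP[bb Nb] := Pb.
  pose W i := interior [set y | forall k, (pi @` B (k, i)) y].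
  have oW : open (box W) by apply: box_open => i; exact: open_interior.
  have Wb : box W (pi_pow pi d (b ord0)).
    move=> i; apply: (@filter_forall _ _ (fun k y => (pi @` B (k, i)) y)
      (nbhs (pi_pow pi d (b ord0) i))) => k.
    apply: open_nbhs_nbhs; split; first exact: opi.
    by exists (b k i); [exact: (Bb (k, i))|exact: bb].
  have [K KP] := minimal_set_syndetic (ap_action hTY d) (ptws_compact cY)
    (Nd_minimal hTY hY cY mY d) oW (ex_intro _ _ (conj Nb Wb)).
  have [g _ Wg] := KP _ Nu.
  exists g, u; split=> // -[k i]; have /interior_subset /(_ k)[x Bx xg] := Wg i.
  by apply: (sB (k, i) isT x) => //; rewrite xg /= /act /diag_act /ap_act /tuple_act epi uu.
have [||||||g0 [z [Pz Uz Bz]]] := IH (fibre_hull U e0) (fibre_hull B e0).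
- exact: fibre_hull_open.
- exact: fibre_hull_open.
- exact: fibre_hull_saturated.
- exact: fibre_hull_saturated.
- by exists u; split=> //; exact: fibre_hull_sub.
- by exists b; split=> //; exact: fibre_hull_sub.
have [x Ux xz] : (pi @` U e0) (pi (eval e0 z)).
  by have := Uz e0; rewrite /fibre_hull eqxx.
apply: (@pair_transitive_step U B e0 g0 (fun k i => if (k, i) == e0 then x else z k i)) => //.
- exact: fibre_pair_replace.
- move=> f; rewrite -surjective_pairing; have [->//|fe0] := eqVneq f e0.
  by have := Uz f; rewrite /fibre_hull (negbTE fe0).
- move=> f; have := Bz f; rewrite /act /diag_act /ap_act /tuple_act -surjective_pairing.
  have [->|//] := eqVneq f e0; rewrite /fibre_hull eqxx => -[v Bv vz].
  by exists v => //; rewrite vz !epi xz.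
Qed.

Lemma pi_pow_weakly_mixing :
  weakly_mixing_ext (Gd_act TX TXinv d) (Gd_act TY TYinv d) (Nd TX TXinv d)
    (Nd TY TYinv d) (pi_pow pi d).
Proof.
split; first exact: (pi_pow_extension hX cX hY hTX mX rpi ric).
apply: (same_maps_transitive (same_maps_diag (Gd_act_same hTX d) 2)).
move=> U V oU oV [u [Uu Pu]] [v [Vv Pv]].
have [U' [oU' U'u U'U]] := pair_box_nbhs oU Uu.
have [V' [oV' V'v V'V]] := pair_box_nbhs oV Vv.
(* Every coordinate is listed, so the saturation conditions hold vacuously. *)
have all_in f : f \in enum {: 'I_2 * 'I_d} by rewrite mem_enum.
have [||||g [z [Pz Uz Vz]]] := @pair_transitive (enum {: 'I_2 * 'I_d}) U' V' oU' oV'.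
- by move=> f; rewrite all_in.
- by move=> f; rewrite all_in.
- by exists u.
- by exists v.
exists g, z; split; first by split=> //; exact: U'U.
by split; [exact: V'V|exact: fibre_pair_invariant].
Qed.

End WeaklyMixingPowers.

Theorem theorem5p11 (R : realType) (X Y : pseudoMetricType R)
  (TX TXinv : X -> X) (TY TYinv : Y -> Y) (pi : X -> Y) :
  hausdorff_space X -> compact [set: X] ->
  hausdorff_space Y -> compact [set: Y] ->
  homeomorphism TX TXinv -> homeomorphism TY TYinv ->
  minimal_set (Tpow TX TXinv) [set: X] -> minimal_set (Tpow TY TYinv) [set: Y] ->
  (forall x x' : X, pi x = pi x' -> RPinf TX TXinv x x') ->
  forall d : nat, (1 <= d)%N ->
  (RIC (Tpow TX TXinv) (Tpow TY TYinv) [set: X] [set: Y] pi ->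
   RIC (Gd_act TX TXinv d) (Gd_act TY TYinv d) (Nd TX TXinv d) (Nd TY TYinv d)
       (pi_pow pi d)) /\
  (RIC (Tpow TX TXinv) (Tpow TY TYinv) [set: X] [set: Y] pi /\
   weakly_mixing_ext (Tpow TX TXinv) (Tpow TY TYinv) [set: X] [set: Y] pi ->
   RIC (Gd_act TX TXinv d) (Gd_act TY TYinv d) (Nd TX TXinv d) (Nd TY TYinv d)
       (pi_pow pi d) /\
   weakly_mixing_ext (Gd_act TX TXinv d) (Gd_act TY TYinv d) (Nd TX TXinv d)
       (Nd TY TYinv d) (pi_pow pi d)).
Proof.
move=> hX cX hY cY hTX hTY mX mY rpi d d0; split=> [ric|[ric [_ wm]]].
  exact: pi_pow_RIC.
split; first exact: pi_pow_RIC.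
exact: (pi_pow_weakly_mixing hX cX hY cY hTX hTY mX mY rpi ric wm d0).
Qed.
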